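(* Let $\gamma$ be a non-collision orbit of the regularized planar two-center problem lying on a regular torus $\mathbb{T}$ with rotation number $W$. Then its bi-infinite syzygy sequence is: $\dots121212\dots$ if $\mathbb{T}$ is of type P; $\dots 1\,3^{n_1}\,2\,3^{n_2}\,1\,3^{n_3}\,2\dots$ if $\mathbb{T}$ is of type L; $\dots 1\,3^{n_1}\,1\,3^{n_2}\,1\,3^{n_3}\,1\dots$ or $\dots 2\,3^{n_1}\,2\,3^{n_2}\,2\,3^{n_3}\,2\dots$ if $\mathbb{T}$ is of type S; where in the L and S cases $(n_i)_{i\in\mathbb{Z}}$ is the Sturmian sequence for rotation number $W$ and some intercept $y_0$. Conversely, in the L and S cases, for every intercept $y_0$ for which the line $y=Wx+y_0$ avoids $\mathbb{Z}^2$, the sequence of the corresponding form with $(n_i)$ the Sturmian sequence for $W$ and $y_0$ is realized by a non-collision orbit on $\mathbb{T}$.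
   Context: Fix $d>0$ and masses $m_1,m_2>0$ at the points $(-d,0)$ and $(d,0)$ of the plane. A test particle moves with Hamiltonian $H=\tfrac12(p_x^2+p_y^2)-m_1/\sqrt{(x+d)^2+y^2}-m_2/\sqrt{(x-d)^2+y^2}$; only energies $h<0$ are considered. Regularization: introduce $(\lambda,\nu)\in\mathbb{R}\times(\mathbb{R}/2\pi\mathbb{Z})$ by $x+iy=d\sin(\nu+i\lambda)$, i.e. $(x,y)=(d\cosh\lambda\sin\nu,\ d\sinh\lambda\cos\nu)$ (a double cover of the plane branched over the two centers, which correspond to $(\lambda,\nu)=(0,\pm\pi/2)$), with conjugate momenta $p_\lambda,p_\nu$, and the time change $dt=d^2(\cosh^2\lambda-\sin^2\nu)\,d\tau$. On the energy level $H=h$ the motion becomes (in time $\tau$) the flow of $H_\lambda(\lambda,p_\lambda)+H_\nu(\nu,p_\nu)$ on its zero level, where $H_\lambda=\tfrac12p_\lambda^2-d(m_1+m_2)\cosh\lambda-hd^2\cosh^2\lambda$ and $H_\nu=\tfrac12p_\nu^2+d(m_1-m_2)\sin\nu+hd^2\sin^2\nu$; each orbit lies in a set $\{H_\lambda=-g,\ H_\nu=g\}$, $g$ being a separation constant (the value of Euler's second integral). Regular torus: a compact connected component $\mathbb{T}=C_\lambda\times C_\nu$ of such a set, where $-g$ is a regular value of $H_\lambda$ and $g$ a regular value of $H_\nu$; $C_\lambda$ is a closed curve in the $(\lambda,p_\lambda)$-plane, $C_\nu$ a closed curve in the cylinder $(\mathbb{R}/2\pi\mathbb{Z})\times\mathbb{R}$.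 Every regular torus is of one of three types: S if $C_\nu$ is contractible in the cylinder; L if $C_\nu$ winds around the cylinder and $C_\lambda$ meets $\{\lambda=0\}$; P if $C_\nu$ winds around the cylinder and $C_\lambda$ does not meet $\{\lambda=0\}$. Rotation number: with $T_\lambda,T_\nu$ the $\tau$-periods of the motions on $C_\lambda$, $C_\nu$, $W=T_\nu/T_\lambda>0$. With angles $\theta_1\in\mathbb{R}/\mathbb{Z}$ along $C_\nu$, $\theta_2\in\mathbb{R}/\mathbb{Z}$ along $C_\lambda$, each increasing uniformly in $\tau$ with period 1, orbits on $\mathbb{T}$ lift to lines $\theta_2=W\theta_1+\mathrm{const}$. Syzygies: the particle is on the $x$-axis iff $\lambda=0$ or $\nu\equiv\pm\pi/2$. Symbol 3: $\lambda=0$, $\nu\not\equiv\pm\pi/2$ (strictly between the centers); symbol 1: $\nu\equiv-\pi/2$, $\lambda\neq0$ ($x<-d$); symbol 2: $\nu\equiv\pi/2$, $\lambda\neq0$ ($x>d$). Collision points: $\lambda=0$, $\nu\equiv\pm\pi/2$. A non-collision orbit is an orbit of the regularized flow on a regular torus containing no collision point; its syzygy sequence is the bi-infinite sequence of symbols recorded in time order. Sturmian sequence: for $m>0$ and $y_0$ with the line $y=mx+y_0$ avoiding $\mathbb{Z}^2$, put $y_k=y_0+km$ and, for $k\in\mathbb{Z}$, $n_k=\lfloor m\rfloor$ if $\{y_{k-1}\}+\{m\}<1$, $n_k=\lfloor m\rfloor+1$ if $\{y_{k-1}\}+\{m\}>1$ ($\lfloor\cdot\rfloor$ floor, $\{\cdot\}$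 fractional part). *)

(* Defs.v *)
From HB Require Import structures.
From mathcomp Require Import all_boot all_order all_algebra.
From mathcomp Require Import all_classical all_reals all_analysis.
Set Implicit Arguments. Unset Strict Implicit. Unset Printing Implicit Defensive.
Import Order.TTheory GRing.Theory Num.Theory.
Import numFieldNormedType.Exports.
Local Open Scope classical_set_scope.
Local Open Scope ring_scope.

Section TwoCenter.
Variable R : realType.

Definition coshR (x : R) : R := (expR x + expR (- x)) / 2.
Definition sinhR (x : R) : R := (expR x - expR (- x)) / 2.

Definition Hlam (d m1 m2 h : R) (l p : R) : R :=
  p ^+ 2 / 2 - d * (m1 + m2) * coshR l - h * d ^+ 2 * coshR l ^+ 2.
(* H_nu(v, p) = p^2/2 + d(m1-m2) sin v + h d^2 sin^2 v   (v : lift of nu to R) *)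
Definition Hnu (d m1 m2 h : R) (v p : R) : R :=
  p ^+ 2 / 2 + d * (m1 - m2) * sin v + h * d ^+ 2 * sin v ^+ 2.

Definition dHlam (d m1 m2 h : R) (l : R) : R :=
  - d * (m1 + m2) * sinhR l - 2 * h * d ^+ 2 * coshR l * sinhR l.
Definition dHnu (d m1 m2 h : R) (v : R) : R :=
  d * (m1 - m2) * cos v + 2 * h * d ^+ 2 * sin v * cos v.

(* level sets (the nu-level set is taken in the universal cover R x R
   of the cylinder (R/2piZ) x R) *)
Definition lev_lam (d m1 m2 h : R) (c : R) : set (R * R) :=
  [set z | Hlam d m1 m2 h z.1 z.2 = c].
Definition lev_nu (d m1 m2 h : R) (c : R) : set (R * R) :=
  [set z | Hnu d m1 m2 h z.1 z.2 = c].

Definition regular_lam (d m1 m2 h : R) (c : R) : Prop :=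
  forall l p, Hlam d m1 m2 h l p = c -> (dHlam d m1 m2 h l != 0) \/ (p != 0).
Definition regular_nu (d m1 m2 h : R) (c : R) : Prop :=
  forall v p, Hnu d m1 m2 h v p = c -> (dHnu d m1 m2 h v != 0) \/ (p != 0).

Definition lam_sol (d m1 m2 h : R) (l pl : R -> R) : Prop :=
  forall t : R, is_derive t (1 : R) l (pl t) /\ is_derive t 1 pl (- dHlam d m1 m2 h (l t)).
Definition nu_sol (d m1 m2 h : R) (v pv : R -> R) : Prop :=
  forall t : R, is_derive t (1 : R) v (pv t) /\ is_derive t 1 pv (- dHnu d m1 m2 h (v t)).

(* an orbit of the regularized flow H_lambda + H_nu, nu lifted to R *)
Definition reg_orbit (d m1 m2 h : R) (l pl v pv : R -> R) : Prop :=
  lam_sol d m1 m2 h l pl /\ nu_sol d m1 m2 h v pv.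

Definition eqmod2pi (x a : R) : Prop := exists k : int, x = a + k%:~R * (2 * pi).

Definition lam_period (d m1 m2 h : R) (Cl : set (R * R)) (T : R) : Prop :=
  forall l pl, lam_sol d m1 m2 h l pl -> Cl (l 0, pl 0) ->
    0 < T /\ (forall t, l (t + T) = l t /\ pl (t + T) = pl t) /\
    (forall T', 0 < T' < T -> ~ (forall t, l (t + T') = l t /\ pl (t + T') = pl t)).

(* T is the tau-period of the motion on C_nu, the curve of the cylinder whose
   lift to R x R contains the connected component K *)
Definition nu_period (d m1 m2 h : R) (K : set (R * R)) (T : R) : Prop :=
  forall v pv, nu_sol d m1 m2 h v pv -> K (v 0, pv 0) ->
    0 < T /\ (forall t, eqmod2pi (v (t + T)) (v t) /\ pv (t + T) = pv t) /\
    (forall T', 0 < T' < T ->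
       ~ (forall t, eqmod2pi (v (t + T')) (v t) /\ pv (t + T') = pv t)).

(* the orbit lies on the torus C_lambda x C_nu, where C_nu is the projection
   of the lifted component K *)
Definition on_torus (Cl K : set (R * R)) (l pl v pv : R -> R) : Prop :=
  Cl (l 0, pl 0) /\ exists k : int, K (v 0 + k%:~R * (2 * pi), pv 0).

(* C_nu winds around the cylinder: its lift connects a point to its
   2pi-translate; C_nu is contractible iff it does not wind *)
Definition winds (K : set (R * R)) : Prop :=
  exists x p, K (x, p) /\ K (x + 2 * pi, p).
Definition meets_lam0 (Cl : set (R * R)) : Prop := exists p, Cl (0, p).

Definition typeS (Cl K : set (R * R)) : Prop := ~ winds K.
Definition typeL Cl K : Prop := winds K /\ meets_lam0 Cl.
Definition typeP Cl K : Prop := winds K /\ ~ meets_lam0 Cl.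

Definition noncollision (l v : R -> R) : Prop :=
  forall t, ~ (l t = 0 /\ (eqmod2pi (v t) (pi / 2) \/ eqmod2pi (v t) (- (pi / 2)))).

Definition syz (l v : R -> R) (t : R) (a : nat) : Prop :=
  (a = 3%N /\ l t = 0 /\ ~ eqmod2pi (v t) (pi / 2) /\ ~ eqmod2pi (v t) (- (pi / 2))) \/
  (a = 1%N /\ eqmod2pi (v t) (- (pi / 2)) /\ l t != 0) \/
  (a = 2%N /\ eqmod2pi (v t) (pi / 2) /\ l t != 0).

Definition syzygy_seq (l v : R -> R) (s : int -> nat) : Prop :=
  exists tt : int -> R,
    (forall k, tt k < tt (k + 1)) /\
    (forall t, (exists a, syz l v t a) <-> exists k, tt k = t) /\
    (forall k, syz l v (tt k) (s k)).

Definition fracR (x : R) : R := x - (Num.floor x)%:~R.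
Definition avoids_lattice (m y0 : R) : Prop :=
  forall x y : int, y%:~R != m * x%:~R + y0.
Definition sturm (m y0 : R) (k : int) : int :=
  if fracR (y0 + (k - 1)%:~R * m) + fracR m < 1 then Num.floor m
  else Num.floor m + 1.

(* s = ... sep_0 3^{n_1} sep_1 3^{n_2} sep_2 3^{n_3} ... *)
Definition block_form (s : int -> nat) (sep : int -> nat) (n : int -> int) : Prop :=
  exists j : int -> int,
    (forall i, j i < j (i + 1)) /\
    (forall i, s (j i) = sep i) /\
    (forall i k, j i < k < j (i + 1) -> s k = 3%N) /\
    (forall i, j (i + 1) - j i - 1 = n (i + 1)).

Definition sepL (i : int) : nat := if (2 %| i)%Z then 1%N else 2%N.

End TwoCenter.

(* Main.v *)
Require Import Defs.
From HB Require Import structures.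
From mathcomp Require Import all_boot all_order all_algebra.
From mathcomp Require Import all_classical all_reals all_analysis.
From mathcomp Require Import ring lra zify.
Import Order.TTheory GRing.Theory Num.Theory.
Import numFieldNormedType.Exports.
Local Open Scope classical_set_scope.
Local Open Scope ring_scope.

(** Both separated motions are one-dimensional Newton equations with a
    reflection symmetry: lambda -> - lambda, and nu -> 2 c - nu about each angle
    c = +-pi/2.  By uniqueness of solutions the zeros of lambda are therefore
    spaced by exactly Tl/2, and the passages of nu through +-pi/2 by exactly
    Tn/2.  In units of Tl/2, measured from a zero of lambda, the latter occur at
    y0 + i W, so the number of symbols 3 between two consecutive ones is
    floor(y0 + (i+1) W) - floor(y0 + i W), a Sturmian sequence.  Which of these
    events occur at all is decided by the potentials, which are quadratic
    polynomials in cosh lambda (convex) and in sin nu (concave).  For the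
    converse, a global orbit on the torus exists by Picard iteration, and a time
    shift of lambda alone realizes every intercept. *)

Set Implicit Arguments. Unset Strict Implicit. Unset Printing Implicit Defensive.

(** * Calculus on the real line *)

Lemma quadratic_lt_between (R : realFieldType) (a b c x y z : R) :
  0 < b -> x < z < y -> b * x ^+ 2 - a * x <= c -> b * y ^+ 2 - a * y <= c ->
  b * z ^+ 2 - a * z < c.
Proof.
move=> b_gt0 /andP[xz zy] qx qy; rewrite ltNge; apply/negP => qz.
have : 0 < b * ((y - z) * (z - x) * (y - x)).
  by rewrite !mulr_gt0 ?subr_gt0// (lt_trans xz).
have : 0 <= (y - z) * ((b * z ^+ 2 - a * z) - (b * x ^+ 2 - a * x)).
  by rewrite mulr_ge0 ?subr_ge0 ?(ltW zy)// (le_trans qx).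
have : 0 <= (z - x) * ((b * z ^+ 2 - a * z) - (b * y ^+ 2 - a * y)).
  by rewrite mulr_ge0 ?subr_ge0 ?(ltW xz)// (le_trans qy).
lra.
Qed.

Section Calculus.
Variable R : realType.
Implicit Types (f : R -> R) (t s x a b c : R).

Lemma is_derive_unique f t a b : is_derive t 1 f a -> is_derive t 1 f b -> a = b.
Proof. by move=> [_ <-] [_ <-]. Qed.

Lemma is_derive_shift_arg f t s a :
  is_derive (t + s) 1 f a -> is_derive t 1 (fun u => f (u + s)) a.
Proof.
move=> df; rewrite -[a]mulr1; apply: (@is_derive1_comp R f (fun u => u + s)) => //.
by apply: is_derive_eq; rewrite addr0.
Qed.

Lemma is_derive_opp_arg f t a :
  is_derive (- t) 1 f a -> is_derive t 1 (fun u => f (- u)) (- a).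
Proof. by move=> df; rewrite -mulrN1; exact: (@is_derive1_comp R f -%R). Qed.

Lemma is_derive_continuous f f' : (forall t, is_derive t 1 f (f' t)) -> continuous f.
Proof. by move=> df t; apply/differentiable_continuous/derivable1_diffP; case: (df t). Qed.

Lemma continuous_ivt f a b c : continuous f -> f a <= c <= f b ->
  exists2 t, Num.min a b <= t <= Num.max a b & f t = c.
Proof.
move=> cf /andP[fac cfb].
have [||t] := @IVT R f (Num.min a b) (Num.max a b) c _ (continuous_subspaceT cf).
- by rewrite ge_min le_max lexx.
- by case: (leP a b) => _; rewrite ge_min le_max fac cfb ?orbT.
- by rewrite in_itv; exists t.
Qed.

Lemma continuous_neq0_sign f (A : set R) : continuous f -> is_interval A ->
  (forall t, A t -> f t != 0) ->
  (forall t, A t -> 0 < f t) \/ (forall t, A t -> f t < 0).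
Proof.
move=> cf itvA f_neq0.
have [[s As fs]|f_le0] := pselect (exists2 s, A s & 0 < f s); [left|right] => t At.
  rewrite ltNge; apply/negP => ft.
  have [|u tus /eqP] := @continuous_ivt f t s 0 cf; first by rewrite ft ltW.
  apply/negP/f_neq0; move: tus.
  by case: (leP t s) => _; [exact: itvA At As u | exact: itvA As At u].
rewrite lt_neqAle f_neq0//= leNgt; apply/negP => ft.
by apply: f_le0; exists t.
Qed.

Lemma is_derive_mvt f f' a b : (forall t, is_derive t 1 f (f' t)) -> a < b ->
  exists2 c, a < c < b & f b - f a = f' c * (b - a).
Proof.
move=> df ab; have [|c + fab] := MVT ab (fun t _ => df t).
  exact/continuous_subspaceT/is_derive_continuous.
by rewrite in_itv; exists c.
Qed.

Lemma is_derive_ge0_le f f' a b : (forall t, is_derive t 1 f (f' t)) ->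
  (forall t, a < t < b -> 0 <= f' t) -> a <= b -> f a <= f b.
Proof.
move=> df f'_ge0; rewrite le_eqVlt => /predU1P[->//|ab].
have [c acb fab] := is_derive_mvt df ab.
by rewrite -subr_ge0 fab mulr_ge0 ?f'_ge0// subr_ge0 ltW.
Qed.

Lemma is_derive_gt0_lt f f' a b : (forall t, is_derive t 1 f (f' t)) ->
  (forall t, a < t < b -> 0 < f' t) -> a < b -> f a < f b.
Proof.
move=> df f'_gt0 ab; have [c acb fab] := is_derive_mvt df ab.
by rewrite -subr_gt0 fab mulr_gt0 ?f'_gt0// subr_gt0.
Qed.

Lemma is_derive_eq0_eq f f' a b : (forall t, is_derive t 1 f (f' t)) ->
  (forall t, a < t < b -> f' t = 0) -> a <= b -> f a = f b.
Proof.
move=> df f'_eq0; rewrite le_eqVlt => /predU1P[->//|ab].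
have [c acb fab] := is_derive_mvt df ab.
by apply/esym/eqP; rewrite -subr_eq0 fab f'_eq0// mul0r.
Qed.

Lemma is_derive_neq0_between f f' a b c : (forall t, is_derive t 1 f (f' t)) ->
  continuous f' -> (forall t, a < t < b -> f' t != 0) -> a < c < b ->
  f a < f c < f b \/ f b < f c < f a.
Proof.
move=> df cf' f'_neq0 /andP[ac cb].
have itvab : is_interval [set t | a < t < b].
  by move=> s t /andP[as_ _] /andP[_ tb] u /andP[su ut] /=;
    rewrite (lt_le_trans as_ su) (le_lt_trans ut tb).
have sub_ac t : a < t < c -> a < t < b.
  by case/andP=> -> /lt_trans ->.
have sub_cb t : c < t < b -> a < t < b.
  by case/andP=> /(lt_trans ac) -> ->.
have [f'_gt0|f'_lt0] := continuous_neq0_sign cf' itvab f'_neq0; [left|right].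
  apply/andP; split; apply: (is_derive_gt0_lt df) => // t /[dup] tt.
    by move=> /sub_ac; exact: f'_gt0.
  by move=> /sub_cb; exact: f'_gt0.
have dNf t : is_derive t 1 (fun u => - f u) (- f' t) by exact: is_deriveN.
rewrite -ltrN2 -[f c < _]ltrN2; apply/andP; split;
  apply: (is_derive_gt0_lt dNf) => // t tt; rewrite oppr_gt0; apply: f'_lt0.
  exact: sub_cb.
exact: sub_ac.
Qed.

Lemma is_derive_at_max f f' t : (forall s, is_derive s 1 f (f' s)) ->
  (\forall s \near t, f s <= f t) -> f' t = 0.
Proof.
move=> df /nbhs_ballP[e /= e_gt0 f_max].
apply: (is_derive_unique (df t)).
apply: (@derive1_at_max R f (t - e) (t + e)).
- by rewrite lerBlDr -addrA lerDl addr_ge0// ltW.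
- by move=> s _; case: (df s).
- by rewrite in_itv/= ltrBlDr !ltrDl e_gt0.
- by move=> s; rewrite in_itv/= => ts; apply: f_max; rewrite -ball_normE/= distrC ltr_distl.
Qed.

Lemma is_derive_at_min f f' t : (forall s, is_derive s 1 f (f' s)) ->
  (\forall s \near t, f t <= f s) -> f' t = 0.
Proof.
move=> df f_min; apply/eqP; rewrite -oppr_eq0; apply/eqP.
apply: (@is_derive_at_max (fun s => - f s) (fun s => - f' s)).
by near=> s; rewrite lerN2; near: s.
Unshelve. all: by end_near. Qed.

Lemma continuous_has_antiderivative f c : continuous f ->
  exists F, F 0 = c /\ forall t, is_derive t 1 F (f t).
Proof.
move=> cf; pose I a b := (\int[lebesgue_measure]_(t in `[a, b]) f t)%R.
have fint a b : lebesgue_measure.-integrable `[a, b] (EFin \o f).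
  apply: continuous_compact_integrable; first exact: segment_compact.
  exact: continuous_subspaceT.
have chasles a b d : a <= b -> b <= d -> I a d - I a b = I b d.
  move=> ab bd; rewrite /I Rintegral_itvB ?bnd_simp// Rintegral_itv_obnd_cbnd//.
  by apply: integrableS (fint b d); [..|exact: subset_itv_oc_cc].
(* the integral from 0 to x, whatever the sign of x *)
pose F x := I 0 x - I x 0.
have FE a x : a <= 0 -> a <= x -> F x = I a x - I a 0.
  move=> a_le0 ax; rewrite /F; have I_nil u v : u < v -> I v u = 0.
    by move=> uv; rewrite /I set_itv_ge ?Rintegral_set0// bnd_simp -ltNge.
  case: (ltgtP x 0) => [x_lt0|x_gt0|->]; last by rewrite !subrr.
    by rewrite -(chasles a x 0) ?(ltW x_lt0)// I_nil// sub0r opprB.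
  by rewrite (I_nil 0 x)// subr0 -(chasles a 0 x)// ltW.
have dF t : is_derive t 1 F (f t).
  pose a := Num.min 0 t - 1; have [a_lt0 a_lt] : a < 0 /\ a < t.
    by rewrite /a !ltrBlDr !gt_min; split; apply/orP; [left|right]; lra.
  have [|||I_derivable I_derive] := @continuous_FTC1_closed R f a t (t + 1) _ (fint _ _).
  - by rewrite ltrDl.
  - exact: a_lt.
  - exact: cf.
  apply: (@near_eq_is_derive _ _ _ (fun x => I a x - I a 0)).
    near=> x; rewrite (FE a)// ltW//; near: x; exact: lt_nbhsr.
  have dIa : is_derive t 1 (I a) (f t) by apply: DeriveDef; rewrite -?derive1E.
  by apply: is_derive_eq; rewrite subr0.
exists (fun x => F x + c); split; last first.
  by move=> t; rewrite -[f t]addr0; exact: is_deriveD.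
by rewrite /F subrr add0r.
Unshelve. all: by end_near. Qed.

End Calculus.

(** * Second-order equations *)

Section Lipschitz.
Variable R : realType.
Implicit Types (f F : R -> R) (x y t a b L M : R).

Lemma lipschitzP L F :
  L.-lipschitz F <-> forall x y, `|F x - F y| <= L * `|x - y|.
Proof. by split=> [lipF x y|lipF [x y] _]; [exact: (lipF (x, y)) | exact: lipF]. Qed.

Lemma lipschitz_constant_ge0 L F : L.-lipschitz F -> 0 <= L.
Proof.
move=> /lipschitzP lipF; have := le_trans (normr_ge0 _) (lipF 1 0).
by rewrite subr0 normr1 mulr1.
Qed.

Lemma lipschitz_continuous L F : L.-lipschitz F -> continuous F.
Proof.
move=> lipF t; have L_ge0 := lipschitz_constant_ge0 lipF.
move/lipschitzP in lipF; apply/cvgrPdist_lt => e e_gt0; near=> s.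
apply: le_lt_trans (lipF _ _) _; apply: (@le_lt_trans _ _ ((L + 1) * `|t - s|)).
  by rewrite ler_wpM2r// lerDl.
rewrite -ltr_pdivlMl ?ltr_wpDl//; near: s; apply: (@nbhsx_ballx _ _ t).
by rewrite mulr_gt0// invr_gt0 ltr_wpDl.
Unshelve. all: by end_near. Qed.

Lemma lipschitz_of_ordered L F :
  (forall x y, x <= y -> `|F y - F x| <= L * (y - x)) -> L.-lipschitz F.
Proof.
move=> F_le; apply/lipschitzP => x y; case: (leP x y) => [xy|/ltW yx].
  by rewrite distrC [`|x - y|]distrC [`|y - x|]ger0_norm ?subr_ge0// F_le.
by rewrite [`|x - y|]ger0_norm ?subr_ge0// F_le.
Qed.

Lemma is_derive_dist_le f f' L a b : (forall t, is_derive t 1 f (f' t)) ->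
  (forall t, a < t < b -> `|f' t| <= L) -> a <= b -> `|f b - f a| <= L * (b - a).
Proof.
move=> df f'_le; rewrite le_eqVlt => /predU1P[->|ab]; first by rewrite !subrr normr0 mulr0.
have [c acb ->] := is_derive_mvt df ab.
by rewrite normrM [`|b - a|]gtr0_norm ?subr_gt0// ler_pM2r ?subr_gt0 ?f'_le.
Qed.

Lemma is_derive_lipschitz f f' L : (forall t, is_derive t 1 f (f' t)) ->
  (forall t, `|f' t| <= L) -> L.-lipschitz f.
Proof.
move=> df f'_le; apply: lipschitz_of_ordered => x y.
by apply: (is_derive_dist_le df) => t _; exact: f'_le.
Qed.

Definition clamp M x : R := Num.max (- M) (Num.min x M).

Lemma clamp_id M x : - M <= x <= M -> clamp M x = x.
Proof. by move=> /andP[Mx xM]; rewrite /clamp min_l// max_r. Qed.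

Lemma clamp_cases M x : 0 <= M -> [\/ x <= - M /\ clamp M x = - M,
  - M <= x <= M /\ clamp M x = x | M <= x /\ clamp M x = M].
Proof.
move=> M_ge0; have MM : - M <= M by rewrite (le_trans _ M_ge0)// oppr_le0.
have [xM|/ltW Mx] := leP x (- M).
  by apply: Or31; rewrite /clamp min_l ?max_l// (le_trans xM).
have [xM|/ltW Mx'] := leP x M; first by apply: Or32; rewrite clamp_id ?Mx.
by apply: Or33; rewrite /clamp min_r ?max_r.
Qed.

Lemma clamp_bound M x : 0 <= M -> - M <= clamp M x <= M.
Proof. by move=> M_ge0; case: (clamp_cases x M_ge0) => -[? ->]; lra. Qed.

Lemma clampN M x : 0 <= M -> clamp M (- x) = - clamp M x.
Proof.
move=> M_ge0; have [] := clamp_cases x M_ge0; have [] := clamp_cases (- x) M_ge0;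
  by move=> [? ->] [? ->]; lra.
Qed.

Lemma clamp_dist_le M x y : 0 <= M -> x <= y -> 0 <= clamp M y - clamp M x <= y - x.
Proof.
move=> M_ge0 xy; have [] := clamp_cases x M_ge0; have [] := clamp_cases y M_ge0;
  by move=> [? ->] [? ->]; lra.
Qed.

Lemma clamp_lipschitz f f' M : 0 <= M -> (forall t, is_derive t 1 f (f' t)) ->
  continuous f' -> exists L, L.-lipschitz (f \o clamp M).
Proof.
move=> M_ge0 df cf'; have MM : - M <= M by rewrite (le_trans _ M_ge0)// oppr_le0.
have cnf' : continuous (Num.norm \o f').
  by move=> t; apply: continuous_comp; [exact: cf'|exact: norm_continuous].
have [tM _ f'_le] := EVT_max MM (continuous_subspaceT cnf').
exists `|f' tM|; apply: lipschitz_of_ordered => x y xy.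
have /andP[c_ge0 c_le] := clamp_dist_le M_ge0 xy.
have /andP[cx _] := clamp_bound x M_ge0; have /andP[_ cy] := clamp_bound y M_ge0.
apply: le_trans (ler_wpM2l (normr_ge0 _) c_le).
apply: (is_derive_dist_le df) => [t /andP[xt ty]|]; last by rewrite -subr_ge0.
by apply: f'_le; rewrite in_itv/= (le_trans cx (ltW xt)) (le_trans (ltW ty) cy).
Qed.

End Lipschitz.

Section Comparison.
Variable R : realType.
Implicit Types (w y z : R -> R) (C t : R).

Lemma gronwall_eq0 w w' C t0 : (forall t, is_derive t 1 w (w' t)) ->
  (forall t, 0 <= w t) -> (forall t, `|w' t| <= C * w t) -> w t0 = 0 ->
  forall t, w t = 0.
Proof.
move=> dw w_ge0 w'_le wt0 t; wlog t0t : w w' t0 t dw w_ge0 w'_le wt0 / t0 <= t.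
  move=> after_t0; case: (leP t0 t) => [|/ltW tt0]; first exact: (after_t0 w w' t0 t).
  rewrite -[t]opprK; apply: (after_t0 (fun s => w (- s)) (fun s => - w' (- s)) (- t0)) => //.
  - by move=> s; exact: is_derive_opp_arg.
  - by move=> s; rewrite normrN.
  - by rewrite /= opprK.
  - by rewrite lerN2.
pose E (s : R) := - (expR (- C * s) * w s).
have dE (s : R) : is_derive s 1 E (expR (- C * s) * (C * w s - w' s)).
  have dexp : is_derive s 1 (fun u => expR (- C * u)) (expR (- C * s) * - C).
    by apply: is_derive1_comp; apply: is_derive_eq; rewrite /GRing.scale/= mulr1.
  by apply: is_derive_eq; rewrite /GRing.scale/=; ring.
have : E t0 <= E t.
  apply: (is_derive_ge0_le dE) => // s _; rewrite mulr_ge0 ?expR_ge0// subr_ge0.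
  exact: le_trans (ler_norm _) (w'_le s).
rewrite /E wt0 mulr0 oppr0 oppr_ge0 pmulr_rle0 ?expR_gt0// => wt_le0.
by apply/eqP; rewrite eq_le wt_le0 w_ge0.
Qed.

Lemma second_derivative_ge0 z z' z'' : (forall t, is_derive t 1 z (z' t)) ->
  (forall t, is_derive t 1 z' (z'' t)) -> z 0 = 0 -> z' 0 = 0 ->
  (forall t, 0 <= z'' t) -> forall t, 0 <= z t.
Proof.
move=> dz dz' z0 z'0 z''_ge0 t.
have z'_homo a b : a <= b -> z' a <= z' b by exact: (is_derive_ge0_le dz').
case: (leP 0 t) => [t_ge0|/ltW t_le0].
  rewrite -z0; apply: (is_derive_ge0_le dz) t_ge0 => s /andP[s_gt0 _].
  by rewrite -z'0 z'_homo// ltW.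
rewrite -oppr_le0 -oppr0 -[X in _ <= - X]z0.
apply: (@is_derive_ge0_le _ (fun s => - z s) (fun s => - z' s)) t_le0 => s /andP[_ s_lt0].
by rewrite oppr_ge0 -z'0 z'_homo// ltW.
Qed.

Lemma second_derivative_norm_le z z' z'' y y' y'' :
  (forall t, is_derive t 1 z (z' t)) -> (forall t, is_derive t 1 z' (z'' t)) ->
  (forall t, is_derive t 1 y (y' t)) -> (forall t, is_derive t 1 y' (y'' t)) ->
  z 0 = 0 -> z' 0 = 0 -> y 0 = 0 -> y' 0 = 0 ->
  (forall t, `|z'' t| <= y'' t) -> forall t, `|z t| <= y t.
Proof.
move=> dz dz' dy dy' z0 z'0 y0 y'0 z''_le t.
rewrite ler_norml lerNl -subr_ge0 -[_ <= y t]subr_ge0 opprK.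
have bounds s : 0 <= y'' s + z'' s /\ 0 <= y'' s - z'' s.
  have := z''_le s; rewrite ler_norml lerNl -subr_ge0 opprK => /andP[-> ?].
  by rewrite subr_ge0.
apply/andP; split.
  apply: (@second_derivative_ge0 (y \+ z) (y' \+ z') (y'' \+ z'')) => [||s] /=;
    rewrite ?y0 ?z0 ?y'0 ?z'0 ?addr0//; exact: (bounds s).1.
apply: (@second_derivative_ge0 (y \- z) (y' \- z') (y'' \- z'')) => [||s] /=;
  rewrite ?y0 ?z0 ?y'0 ?z'0 ?subr0//; exact: (bounds s).2.
Qed.

End Comparison.

Section Hyperbolic.
Variable R : realType.
Implicit Types K t x y : R.

Lemma is_derive_coshR t : is_derive t 1 (@coshR R) (sinhR t).
Proof.
have dexpN : is_derive t 1 (fun s : R => expR (- s)) (- expR (- t)).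
  exact: is_derive_opp_arg.
by apply: is_derive_eq; rewrite /sinhR /GRing.scale/=; field.
Qed.

Lemma is_derive_sinhR t : is_derive t 1 (@sinhR R) (coshR t).
Proof.
have dexpN : is_derive t 1 (fun s : R => expR (- s)) (- expR (- t)).
  exact: is_derive_opp_arg.
by apply: is_derive_eq; rewrite /coshR /GRing.scale/=; field.
Qed.

Lemma is_derive_coshR_scale K t :
  is_derive t 1 (fun s => coshR (K * s)) (K * sinhR (K * t)).
Proof.
have dK : is_derive t 1 (fun s => K * s) K.
  by apply: is_derive_eq; rewrite /GRing.scale/= mulr1.
by rewrite mulrC; exact: is_derive1_comp (is_derive_coshR _) dK.
Qed.

Lemma is_derive_sinhR_scale K t :
  is_derive t 1 (fun s => sinhR (K * s)) (K * coshR (K * t)).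
Proof.
have dK : is_derive t 1 (fun s => K * s) K.
  by apply: is_derive_eq; rewrite /GRing.scale/= mulr1.
by rewrite mulrC; exact: is_derive1_comp (is_derive_sinhR _) dK.
Qed.

Lemma coshR0 : coshR 0 = 1 :> R.
Proof. by rewrite /coshR oppr0 expR0; lra. Qed.

Lemma sinhR0 : sinhR 0 = 0 :> R.
Proof. by rewrite /sinhR oppr0 subrr mul0r. Qed.

Lemma coshRN t : coshR (- t) = coshR t.
Proof. by rewrite /coshR opprK addrC. Qed.

Lemma sinhRN t : sinhR (- t) = - sinhR t.
Proof. by rewrite /sinhR opprK -mulNr opprB. Qed.

Lemma sinhR_gt0 t : 0 < t -> 0 < sinhR t.
Proof. by move=> t_gt0; rewrite divr_gt0// subr_gt0 ltr_expR; lra. Qed.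

Lemma coshR_norm t : coshR `|t| = coshR t.
Proof. by case: (ger0P t) => _; rewrite ?coshRN. Qed.

Lemma ltr_coshR_norm x y : `|x| < `|y| -> coshR x < coshR y.
Proof.
move=> xy; rewrite -(coshR_norm x) -(coshR_norm y).
apply: (is_derive_gt0_lt is_derive_coshR _ xy) => t /andP[xt _].
exact/sinhR_gt0/(le_lt_trans _ xt).
Qed.

Lemma coshR_ge1 t : 1 <= coshR t.
Proof.
have [->|t_neq0] := eqVneq t 0; first by rewrite coshR0.
by rewrite -coshR0 ltW// ltr_coshR_norm// normr0 normr_gt0.
Qed.

Lemma coshR_ge_affine t : (1 + `|t|) / 2 <= coshR t.
Proof.
rewrite -coshR_norm /coshR ler_pM2r ?invr_gt0// -[X in X <= _]addr0.
by rewrite lerD ?expR_ge1Dx ?expR_ge0.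
Qed.

End Hyperbolic.

Section NewtonEquation.
Variable R : realType.
Implicit Types (F U V x p y q : R -> R) (t s a c L : R).

Definition ode_sol F x p : Prop :=
  forall t, is_derive t 1 x (p t) /\ is_derive t 1 p (F (x t)).

Lemma ode_sol_continuous F x p : ode_sol F x p -> continuous x /\ continuous p.
Proof.
move=> sol; split; first exact: is_derive_continuous (fun t => (sol t).1).
exact: is_derive_continuous (fun t => (sol t).2).
Qed.

Lemma ode_sol_shift F x p s : ode_sol F x p ->
  ode_sol F (fun t => x (t + s)) (fun t => p (t + s)).
Proof. by move=> sol t; split; apply: is_derive_shift_arg; have [] := sol (t + s). Qed.

Lemma ode_sol_reverse F x p : ode_sol F x p ->
  ode_sol F (fun t => x (- t)) (fun t => - p (- t)).
Proof.
move=> sol t; have [dx dp] := sol (- t); split; first exact: is_derive_opp_arg.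
by have := is_derive_opp_arg dp => dpN; apply: is_derive_eq; rewrite opprK.
Qed.

Lemma ode_sol_reflect F x p c : (forall a, F (c + c - a) = - F a) ->
  ode_sol F x p -> ode_sol F (fun t => c + c - x t) (fun t => - p t).
Proof.
move=> symF sol t; have [dx dp] := sol t; rewrite symF.
split; last exact: is_deriveN.
by apply: is_derive_eq; ring.
Qed.

Lemma ode_sol_energy_primitive F U x p : (forall a, is_derive a 1 U (F a)) ->
  ode_sol F x p -> forall t s, p t ^+ 2 / 2 - U (x t) = p s ^+ 2 / 2 - U (x s).
Proof.
move=> dU sol t s; apply: (@is_derive_0_is_cst R (fun t => p t ^+ 2 / 2 - U (x t))) => u.
have [dx dp] := sol u; have dUx := is_derive1_comp (dU (x u)) dx.
by apply: is_derive_eq; rewrite /GRing.scale/=; field.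
Qed.

Lemma ode_sol_energy V V' x p : (forall a, is_derive a 1 V (V' a)) ->
  ode_sol (fun a => - V' a) x p ->
  forall t s, p t ^+ 2 / 2 + V (x t) = p s ^+ 2 / 2 + V (x s).
Proof.
move=> dV sol t s; have dVN a : is_derive a 1 (fun b => - V b) (- V' a) by exact: is_deriveN.
by have := ode_sol_energy_primitive dVN sol t s; rewrite !opprK.
Qed.

Lemma ode_sol_speed F x p t s : continuous F -> ode_sol F x p ->
  x t = x s -> p t ^+ 2 = p s ^+ 2.
Proof.
move=> cF sol xts; have [U [_ dU]] := continuous_has_antiderivative 0 cF.
by have := ode_sol_energy_primitive dU sol t s; rewrite xts; lra.
Qed.

(* The squared phase-space distance of two solutions satisfies |w'| <= (1 + L) w. *)
Lemma ode_sol_unique F L x p y q t0 : L.-lipschitz F -> ode_sol F x p ->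
  ode_sol F y q -> x t0 = y t0 -> p t0 = q t0 ->
  forall t, x t = y t /\ p t = q t.
Proof.
move=> lipF solx soly xy0 pq0 t; have L_ge0 := lipschitz_constant_ge0 lipF.
move/lipschitzP in lipF; pose w s := (x s - y s) ^+ 2 + (p s - q s) ^+ 2.
pose w' s := 2 * ((x s - y s) * (p s - q s)) + 2 * ((F (x s) - F (y s)) * (p s - q s)).
have dw s : is_derive s 1 w (w' s).
  have [dx dp] := solx s; have [dy dq] := soly s.
  by apply: is_derive_eq; rewrite /w' /GRing.scale/=; ring.
have w'_le s : `|w' s| <= (1 + L) * w s.
  have amgm : 2 * (`|x s - y s| * `|p s - q s|) <= w s.
    rewrite /w -[(x s - _) ^+ 2]real_normK ?num_real//.
    rewrite -[(p s - _) ^+ 2]real_normK ?num_real//.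
    by have := sqr_ge0 (`|x s - y s| - `|p s - q s|); lra.
  rewrite /w' (le_trans (ler_normD _ _))// !normrM normr_nat [leRHS]mulrDl mul1r lerD//.
  apply: le_trans (ler_wpM2l L_ge0 amgm); rewrite [leRHS]mulrCA ler_pM2l// mulrA.
  by rewrite ler_wpM2r.
have w_ge0 s : 0 <= w s by rewrite addr_ge0// sqr_ge0.
have w0 : w t0 = 0 by rewrite /w xy0 pq0 !subrr expr0n addr0.
have /eqP := gronwall_eq0 dw w_ge0 w'_le w0 t; rewrite paddr_eq0 ?sqr_ge0//.
by rewrite !sqrf_eq0 !subr_eq0 => /andP[/eqP-> /eqP->].
Qed.

End NewtonEquation.

Section GeometricConvergence.
Variable R : realType.
Implicit Types (t a c C : R).

Lemma exists_half_pow_lt c (e : R) : 0 < e -> exists n, c / 2 ^+ n < e.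
Proof.
move=> e_gt0; exists (Num.truncn (c / e)).+1.
rewrite ltr_pdivrMr ?exprn_gt0// -ltr_pdivrMl// mulrC.
apply: lt_trans (truncnS_gt _) _.
by rewrite -natrX ltr_nat ltn_expl.
Qed.

Lemma half_pow_le_eq0 a c : (forall n, `|a| <= c / 2 ^+ n) -> a = 0.
Proof.
move=> a_le; apply/eqP; rewrite -normr_le0 leNgt; apply/negP => /(exists_half_pow_lt c)[n].
by rewrite ltNge a_le.
Qed.

Lemma half_pow_cauchy_limit (u : R^nat) c :
  (forall n, `|u n.+1 - u n| <= c / 2 ^+ n) ->
  exists l, forall n, `|l - u n| <= 2 * c / 2 ^+ n.
Proof.
move=> u_le; have halve n : 2 * c / 2 ^+ n.+1 = c / 2 ^+ n.
  by rewrite exprS invfM mulrACA divff ?mul1r// pnatr_eq0.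
have double n : 2 * c / 2 ^+ n = c / 2 ^+ n + c / 2 ^+ n by rewrite -!mulrA mulr_natl mulr2n.
have c_ge0 n : 0 <= 2 * c / 2 ^+ n.
  by rewrite double addr_ge0 ?(le_trans (normr_ge0 _) (u_le n)).
pose lower n := u n - 2 * c / 2 ^+ n; pose upper n := u n + 2 * c / 2 ^+ n.
have lower_nd : nondecreasing_seq lower.
  apply/nondecreasing_seqP => n; rewrite /lower halve double.
  by have := u_le n; rewrite ler_norml => /andP[]; lra.
have upper_ni : nonincreasing_seq upper.
  apply/nonincreasing_seqP => n; rewrite /upper halve double.
  by have := u_le n; rewrite ler_norml => /andP[]; lra.
have lower_upper n m : lower n <= upper m.
  rewrite (le_trans (lower_nd _ _ (leq_maxl n m)))//.
  rewrite (le_trans _ (upper_ni _ _ (leq_maxr n m)))//.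
  by rewrite /lower /upper lerD2l ge0_cp.
have lower_cvg : cvgn lower.
  by apply: nondecreasing_is_cvgn => //; exists (upper 0) => _ [n _ <-].
exists (limn lower) => n; rewrite ler_distl.
rewrite nondecreasing_cvgn_le//=; apply: limr_le => //.
by apply: nearW => m; exact: lower_upper.
Qed.

Lemma weighted_uniform_limit (u : nat -> R -> R) (w : R -> R) C : continuous w ->
  (forall n, continuous (u n)) ->
  (forall n t, `|u n.+1 t - u n t| <= C / 2 ^+ n * w t) ->
  exists x, continuous x /\ forall n t, `|x t - u n t| <= 2 * C / 2 ^+ n * w t.
Proof.
move=> cw cu u_le.
have lim t : exists l, forall n, `|l - u n t| <= 2 * (C * w t) / 2 ^+ n.
  by apply: half_pow_cauchy_limit => n; rewrite mulrAC.
have [x x_le] := boolp.choice lim; exists x; split; last first.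
  move=> n t; have -> : 2 * C / 2 ^+ n * w t = 2 * (C * w t) / 2 ^+ n by ring.
  exact: x_le.
move=> t; apply/cvgrPdist_lt => e e_gt0.
have [n n_lt] : exists n, 2 * (`|C| * (`|w t| + 1)) / 2 ^+ n < e / 3.
  by apply: exists_half_pow_lt; rewrite divr_gt0.
have close s : `|w s| < `|w t| + 1 -> `|x s - u n s| < e / 3.
  move=> ws; apply: le_lt_trans n_lt; apply: le_trans (x_le s n) _.
  rewrite ler_pM2r ?invr_gt0 ?exprn_gt0// ler_pM2l// (le_trans (ler_norm _))// normrM.
  by rewrite ler_wpM2l// ltW.
have xt := close t; rewrite ltrDl ltr01 in xt; move/(_ isT) in xt.
near=> s; have xs : `|x s - u n s| < e / 3.
  apply: close; near: s.
  apply: (@cvgr_lt _ _ _ _ (fun s => `|w s|) _ (cvg_norm (cw t))).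
  by rewrite ltrDl.
have uts : `|u n t - u n s| < e / 3.
  by near: s; have /cvgrPdist_lt := cu n t; apply; rewrite divr_gt0.
have -> : x t - x s = (x t - u n t) + (u n t - u n s) - (x s - u n s) by ring.
rewrite (le_lt_trans (ler_normB _ _))//.
by rewrite (le_lt_trans (lerD (ler_normD _ _) (lexx _)))//; lra.
Unshelve. all: by end_near. Qed.

End GeometricConvergence.

Section Picard.
Variable R : realType.
Implicit Types (x y z : R -> R) (t C : R).
Variables (F : R -> R) (L x0 p0 : R).
Hypothesis lipF : L.-lipschitz F.

Definition picard_step x y : Prop := exists q, [/\ y 0 = x0, q 0 = p0,
  forall t, is_derive t 1 y (q t) & forall t, is_derive t 1 q (F (x t))].

Lemma picard_step_exists x : continuous x -> exists y, picard_step x y.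
Proof.
move=> cx; have cFx : continuous (F \o x).
  by move=> t; apply: continuous_comp; [exact: cx|exact: lipschitz_continuous lipF (x t)].
have [q [q0 dq]] := continuous_has_antiderivative p0 cFx.
have [y [y0 dy]] := continuous_has_antiderivative x0 (is_derive_continuous dq).
by exists y, q.
Qed.

Lemma picard_step_continuous x y : picard_step x y -> continuous y.
Proof. by move=> [q [_ _ dy _]]; exact: is_derive_continuous dy. Qed.

Let L_ge0 : 0 <= L := lipschitz_constant_ge0 lipF.
Let K : R := 1 + 2 * L.

Definition picard_weight t : R := coshR (K * t).

Lemma picard_weight_ge1 t : 1 <= picard_weight t.
Proof. exact: coshR_ge1. Qed.

Lemma picard_weight_continuous : continuous picard_weight.
Proof. exact: is_derive_continuous (is_derive_coshR_scale K). Qed.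

Lemma weighted_second_derivative_bound C z z' z'' : 0 <= C ->
  (forall t, is_derive t 1 z (z' t)) -> (forall t, is_derive t 1 z' (z'' t)) ->
  z 0 = 0 -> z' 0 = 0 -> (forall t, `|z'' t| <= C * K ^+ 2 * picard_weight t) ->
  forall t, `|z t| <= C * picard_weight t.
Proof.
move=> C_ge0 dz dz' z0 z'0 z''_le t.
pose y (s : R) := C * (picard_weight s - 1); pose y' (s : R) := C * (K * sinhR (K * s)).
have dpicard_weight (s : R) : is_derive s 1 picard_weight (K * sinhR (K * s)).
  exact: is_derive_coshR_scale.
have dsinh (s : R) := is_derive_sinhR_scale K s.
have dy (s : R) : is_derive s 1 y (y' s).
  by apply: is_derive_eq; rewrite /y' /GRing.scale/= subr0.
have dy' (s : R) : is_derive s 1 y' (C * K ^+ 2 * picard_weight s).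
  by apply: is_derive_eq; rewrite /picard_weight /GRing.scale/=; ring.
apply: (@le_trans _ _ (y t)); last by rewrite /y ler_wpM2l// gerBl.
apply: (second_derivative_norm_le dz dz' dy dy' z0 z'0) => //.
  by rewrite /y /picard_weight mulr0 coshR0 subrr mulr0.
by rewrite /y' mulr0 sinhR0 !mulr0.
Qed.

Lemma picard_contraction x1 x2 y1 y2 C : picard_step x1 y1 -> picard_step x2 y2 ->
  (forall t, `|x1 t - x2 t| <= C * picard_weight t) ->
  forall t, `|y1 t - y2 t| <= C / 2 * picard_weight t.
Proof.
move=> [q1 [y10 q10 dy1 dq1]] [q2 [y20 q20 dy2 dq2]] x_close t.
have C_ge0 : 0 <= C.
  have := le_trans (normr_ge0 _) (x_close 0).
  by rewrite pmulr_lge0// (lt_le_trans ltr01)// picard_weight_ge1.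
apply: (@weighted_second_derivative_bound _ (y1 \- y2) (q1 \- q2)
  (fun t => F (x1 t) - F (x2 t))) => [|||s] /=.
- by rewrite divr_ge0.
- by rewrite y10 y20 subrr.
- by rewrite q10 q20 subrr.
- move/lipschitzP: lipF => /(_ (x1 s) (x2 s)) /le_trans -> //.
  apply: le_trans (ler_wpM2l L_ge0 (x_close s)) _; rewrite mulrA ler_wpM2r//.
    by rewrite (le_trans ler01)// picard_weight_ge1.
  by rewrite [L * C]mulrC -mulrA ler_wpM2l// /K; have := L_ge0; nra.
Qed.

Lemma picard_first_step y : picard_step (fun t => x0 + p0 * t) y ->
  forall t, `|y t - (x0 + p0 * t)| <= (`|F x0| + `|p0|) * picard_weight t.
Proof.
move=> [q [y0 q0 dy dq]] t.
have daff (s : R) : is_derive s 1 (fun t => x0 + p0 * t) p0.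
  by apply: is_derive_eq; rewrite /GRing.scale/=; ring.
apply: (@weighted_second_derivative_bound _ (fun t => y t - (x0 + p0 * t))
  (fun t => q t - p0) (fun t => F (x0 + p0 * t))) => [|s|||s].
- by rewrite addr_ge0.
- by apply: is_derive_eq; rewrite subr0.
- by rewrite y0 mulr0 addr0 subrr.
- by rewrite q0 subrr.
- have weight_ge1 := picard_weight_ge1 s; have K_ge1 : 1 <= K by rewrite lerDl mulr_ge0.
  have s_le : `|s| <= 2 * picard_weight s.
    have := coshR_ge_affine (K * s).
    rewrite -/(picard_weight s) normrM ger0_norm ?(le_trans ler01)//.
    by have := ler_wpM2r (normr_ge0 s) K_ge1; lra.
  have F_close : `|F (x0 + p0 * s) - F x0| <= L * (`|p0| * `|s|).
    move/lipschitzP: lipF => /(_ (x0 + p0 * s) x0) /le_trans ->//.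
    by rewrite addrC addKr normrM.
  have -> : F (x0 + p0 * s) = F x0 + (F (x0 + p0 * s) - F x0) by ring.
  apply: le_trans (ler_normD _ _) _; rewrite !mulrDl lerD//.
    by rewrite -mulrA ler_peMr// mulr_ege1// expr_ge1// (le_trans ler01).
  apply: (le_trans F_close); rewrite mulrCA -mulrA ler_wpM2l//.
  apply: le_trans (ler_wpM2l L_ge0 s_le) _; rewrite mulrA ler_wpM2r ?(le_trans ler01)//.
  by rewrite /K; have := L_ge0; nra.
Qed.

(* Picard iteration is a contraction for the weight cosh(K t), K = 1 + 2 L,
   which gives a global solution at once. *)
Lemma ode_sol_exists : exists x p, [/\ ode_sol F x p, x 0 = x0 & p 0 = p0].
Proof.
have ex_step x : exists y, continuous x -> picard_step x y.
  have [/picard_step_exists[y]|] := pselect (continuous x); first by exists y.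
  by exists x.
have [P stepP] := boolp.choice ex_step.
pose u n := iter n P (fun t => x0 + p0 * t).
have cu n : continuous (u n).
  elim: n => [|n cun]; last exact: picard_step_continuous (stepP _ cun).
  move=> t; apply: cvgD; first exact: cvg_cst.
  by apply: cvgM; [exact: cvg_cst|exact: cvg_id].
pose C := `|F x0| + `|p0|.
have u_le n t : `|u n.+1 t - u n t| <= C / 2 ^+ n * picard_weight t.
  elim: n t => [|n IHn] t.
    by rewrite expr0 divr1; exact: picard_first_step (stepP _ (cu 0)) t.
  have -> : C / 2 ^+ n.+1 = C / 2 ^+ n / 2 by rewrite exprSr invfM mulrA.
  exact: picard_contraction (stepP _ (cu n.+1)) (stepP _ (cu n)) IHn t.
have [x [cx x_le]] := weighted_uniform_limit picard_weight_continuous cu u_le.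
have Px t : P x t = x t.
  apply/eqP; rewrite -subr_eq0; apply/eqP.
  apply: (half_pow_le_eq0 (c := 2 * C * picard_weight t)) => n.
  have Px_le := picard_contraction (stepP _ cx) (stepP _ (cu n)) (x_le n) t.
  have -> : P x t - x t = (P x t - u n.+1 t) - (x t - u n.+1 t) by ring.
  apply: le_trans (ler_normB _ _) _; apply: le_trans (lerD Px_le (x_le n.+1 t)) _.
  have -> : 2 * C / 2 ^+ n.+1 = 2 * C / 2 ^+ n / 2 by rewrite exprSr invfM mulrA.
  by rewrite -mulrDl -splitr mulrAC.
have [q [y0 q0 dy dq]] := stepP x cx.
have PxE : P x = x by apply/funext.
by exists x, q; rewrite PxE in y0 dy; split=> // t; split.
Qed.

End Picard.

(** * Periodic orbits *)

Section Progressions.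
Variable R : realType.
Implicit Types (t s c : R) (j : int).

Definition progression t0 c : set R := [set t | exists j : int, t = t0 + j%:~R * c].

Lemma int_ind_iff (Q : int -> Prop) : Q 0 -> (forall i, Q i <-> Q (i + 1)) ->
  forall i, Q i.
Proof.
move=> Q0 step; elim=> [//|n /step|n]; first by rewrite intS addrC.
by move=> Qn; apply/step; rewrite intS opprD addrAC addNr add0r.
Qed.

Lemma shift_invariant_intmul (P : R -> Prop) c : (forall t, P (t + c) <-> P t) ->
  forall j t, P (t + j%:~R * c) <-> P t.
Proof.
move=> inv j t; move: j; apply: int_ind_iff; first by rewrite mul0r addr0.
by move=> i; rewrite intrD mulrDl mul1r addrA inv.
Qed.

Lemma shift_additive_intmul (f : R -> R) T c : (forall t, f (t + T) = f t + c) ->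
  forall j t, f (t + j%:~R * T) = f t + j%:~R * c.
Proof.
move=> fT j t; move: j; apply: int_ind_iff; first by rewrite !mul0r !addr0.
by move=> i; rewrite intrD !mulrDl !mul1r !addrA fT; split=> [->|/addIr].
Qed.

Lemma exists_intmul_translate t t0 c : 0 < c ->
  exists j r, t = r + j%:~R * c /\ t0 <= r < t0 + c.
Proof.
move=> c_gt0; pose j := Num.floor ((t - t0) / c).
exists j, (t - j%:~R * c); split; first by rewrite subrK.
have := floor_itv ((t - t0) / c); rewrite -/j intrD => /andP[lej ltj].
rewrite ler_pdivlMr// in lej; rewrite ltr_pdivrMr// in ltj.
by apply/andP; split; lra.
Qed.

End Progressions.

Section PeriodicOrbits.
Variable R : realType.
Implicit Types (F x p : R -> R) (t s T : R).

Definition returns x p T : Prop := forall t, x (t + T) = x t /\ p (t + T) = p t.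

Definition least_period (period : R -> Prop) T : Prop :=
  0 < T /\ period T /\ forall T', 0 < T' < T -> ~ period T'.

Lemma least_period_sub (period period' : R -> Prop) T :
  (forall T', period' T' -> period T') -> period' T ->
  least_period period T -> least_period period' T.
Proof.
move=> sub periodT [T_gt0 [_ minT]]; split=> //; split=> // T' T'_in /sub.
exact: minT T'_in.
Qed.

Lemma periodic_extrema x T : 0 < T -> continuous x -> (forall t, x (t + T) = x t) ->
  exists tm tM, forall t, x tm <= x t <= x tM.
Proof.
move=> T_gt0 cx xT; have cx0T := continuous_subspaceT cx : {within `[0, T], continuous x}.
have [tM _ x_max] := EVT_max (ltW T_gt0) cx0T.
have [tm _ x_min] := EVT_min (ltW T_gt0) cx0T.
exists tm, tM => t; have [j [r [-> /andP[r_ge0 r_lt]]]] := exists_intmul_translate t 0 T_gt0.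
have r0T : r \in `[0, T] by rewrite in_itv/= r_ge0 -[T]add0r ltW.
have -> : x (r + j%:~R * T) = x r.
  by apply/(@shift_invariant_intmul R (fun s => x s = x r) T) => // s; rewrite xT.
by rewrite x_max ?x_min.
Qed.

Lemma nonequilibrium_turning_points F x p T : ode_sol F x p -> 0 < T -> returns x p T ->
  (forall t, F (x t) != 0 \/ p t != 0) ->
  exists tm tM, [/\ p tm = 0, p tM = 0 & x tm < x tM].
Proof.
move=> sol T_gt0 retT noneq; have [cx _] := ode_sol_continuous sol.
have dx t := (sol t).1; have dp t := (sol t).2.
have [tm [tM x_between]] := periodic_extrema T_gt0 cx (fun t => (retT t).1).
have pm : p tm = 0.
  by apply: (is_derive_at_min dx); near=> s; have /andP[] := x_between s.
have pM : p tM = 0.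
  by apply: (is_derive_at_max dx); near=> s; have /andP[] := x_between s.
exists tm, tM; split=> //; have /andP[_ x_le] := x_between tm.
rewrite lt_neqAle x_le andbT; apply/eqP => x_eq.
have xE : x = fun=> x tm.
  by apply/funext => t; apply/eqP; rewrite eq_le {1}x_eq andbC.
have pE : p = fun=> 0.
  apply/funext => t; apply: is_derive_unique (dx t) _.
  by rewrite xE; exact: is_derive_cst.
have F_eq0 : F (x tm) = 0.
  by apply: is_derive_unique (dp tm) _; rewrite pE; exact: is_derive_cst.
by have [] := noneq tm; rewrite ?F_eq0 ?pm eqxx.
Unshelve. all: by end_near. Qed.

Lemma transversal_value_recurs x p T t0 : 0 < T -> (forall t, is_derive t 1 x (p t)) ->
  (forall t, x (t + T) = x t) -> p t0 != 0 ->
  exists2 t1, t0 < t1 < t0 + T & x t1 = x t0.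
Proof.
move=> T_gt0 dx xT /eqP p_neq0; apply: contrapT => no_return.
have cx : continuous (fun t => x t - x t0).
  by move=> t; apply: cvgB; [exact: is_derive_continuous dx t|exact: cvg_cst].
have avoids t : t \in `]t0, t0 + T[ -> x t - x t0 != 0.
  by rewrite in_itv/= => tt0; rewrite subr_eq0; apply/eqP => xt; apply: no_return; exists t.
have near_t0 s : `|t0 - s| < T -> s = t0 \/ exists2 u, u \in `]t0, t0 + T[ & x u = x s.
  rewrite ltr_distlC => /andP[s_gt s_lt].
  have [s_lt0|s_gt0|] := ltgtP s t0; last by left.
    by right; exists (s + T); rewrite ?xT// in_itv/= ltrD2r s_lt0 andbT -ltrBlDr.
  by right; exists s; rewrite // in_itv/= s_gt0.
apply: p_neq0; have [pos|neg] := continuous_neq0_sign cx (@interval_is_interval _ _) avoids.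
  apply: (is_derive_at_min dx); near=> s.
  have [->//|[u u_in <-]] : s = t0 \/ exists2 u, u \in `]t0, t0 + T[ & x u = x s.
    by apply: near_t0; near: s; exact: (@nbhsx_ballx _ _ t0).
  by rewrite -subr_ge0 ltW// pos.
apply: (is_derive_at_max dx); near=> s.
have [->//|[u u_in <-]] : s = t0 \/ exists2 u, u \in `]t0, t0 + T[ & x u = x s.
  by apply: near_t0; near: s; exact: (@nbhsx_ballx _ _ t0).
by rewrite -subr_le0 ltW// neg.
Unshelve. all: by end_near. Qed.

End PeriodicOrbits.

Section SymmetricForce.
Variable R : realType.
Variables (F x p : R -> R) (L T t0 : R).
Hypotheses (lipF : L.-lipschitz F) (sol : ode_sol F x p).
Hypothesis symF : forall a, F (x t0 + x t0 - a) = - F a.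
Hypothesis leastT : least_period (returns x p) T.
Hypothesis p_neq0 : p t0 != 0.

(* The time translate by s solves the same equation, and so does the reflection
   of x about x t0: compare initial data. *)
Lemma center_passage_reflects (s : R) : 0 < s < T -> x (t0 + s) = x t0 ->
  forall t, x (t + s) = x t0 + x t0 - x t /\ p (t + s) = - p t.
Proof.
move=> sT xs; have sol_s := ode_sol_shift s sol.
have /eqP := ode_sol_speed (lipschitz_continuous lipF) sol xs.
rewrite eqf_sqr => /orP[/eqP ps|/eqP ps]; last first.
  apply: (ode_sol_unique lipF sol_s (ode_sol_reflect symF sol) (t0 := t0)) => //.
  by rewrite xs addrK.
by case: leastT => _ [_ /(_ s sT) []]; exact: (ode_sol_unique lipF sol_s sol (t0 := t0)).
Qed.

Lemma center_passage_half_period (s : R) : 0 < s < T -> x (t0 + s) = x t0 -> s = T / 2.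
Proof.
move=> sT xs; have [T_gt0 [retT minT]] := leastT; have /andP[s_gt0 s_lt] := sT.
have reflects := center_passage_reflects sT xs.
have ret2s t : x (t + (s + s)) = x t /\ p (t + (s + s)) = p t.
  rewrite addrA; have [-> ->] := reflects (t + s); have [-> ->] := reflects t.
  by rewrite subKr opprK.
have [s_lt2|s_gt2|//] := ltgtP s (T / 2); exfalso.
  by apply: (@minT (s + s)) => //; apply/andP; split; lra.
apply: (@minT (s + s - T)); first by apply/andP; split; lra.
by move=> t; have [<- <-] := retT (t + (s + s - T)); rewrite -addrA subrK.
Qed.

Lemma center_passages t : x t = x t0 <-> progression t0 (T / 2) t.
Proof.
have [T_gt0 [retT _]] := leastT; have T2_gt0 : 0 < T / 2 by rewrite divr_gt0.
have [|t1 /andP[t1_gt t1_lt] xt1] :=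
  transversal_value_recurs T_gt0 (fun t => (sol t).1) _ p_neq0.
  by move=> s; exact: (retT s).1.
have t1_in : 0 < t1 - t0 < T by rewrite subr_gt0 t1_gt ltrBlDl.
have xt1' : x (t0 + (t1 - t0)) = x t0 by rewrite subrKC.
have reflects := center_passage_reflects t1_in xt1'.
rewrite (center_passage_half_period t1_in xt1') in reflects.
have inv s : x (s + T / 2) = x t0 <-> x s = x t0.
  by rewrite (reflects s).1; split=> [|->]; lra.
split=> [xt|[j ->]]; last exact/(shift_invariant_intmul inv).
have [j [r [tE /andP[r_ge r_lt]]]] := exists_intmul_translate t t0 T2_gt0.
exists j; rewrite tE; congr (_ + _); apply/eqP; rewrite eq_le r_ge andbT leNgt.
apply/negP => r_gt; have xr : x (t0 + (r - t0)) = x t0.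
  by rewrite subrKC; apply/(shift_invariant_intmul inv j); rewrite -tE.
suff: r - t0 = T / 2 by lra.
by apply: center_passage_half_period => //; apply/andP; split; lra.
Qed.

End SymmetricForce.

(** * The motion in lambda *)

Section PotentialWell.
Variable R : realType.
Variables (V V' V'' : R -> R) (M E : R).
Hypotheses (dV : forall a : R, is_derive a 1 V (V' a)).
Hypotheses (dV' : forall a : R, is_derive a 1 V' (V'' a)) (cV'' : continuous V'').
Hypotheses (M_gt0 : 0 < M) (well : forall a, M <= `|a| -> E < V a).

Definition frozen_force (a : R) : R := - V' (clamp M a).

Lemma frozen_force_id a : `|a| <= M -> frozen_force a = - V' a.
Proof. by move=> aM; rewrite /frozen_force clamp_id// -ler_norml. Qed.

Lemma frozen_forceN : (forall a, V' (- a) = - V' a) ->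
  forall a, frozen_force (- a) = - frozen_force a.
Proof. by move=> oddV' a; rewrite /frozen_force clampN ?oddV'// ltW. Qed.

Lemma frozen_force_lipschitz : exists L, L.-lipschitz frozen_force.
Proof.
apply: (@clamp_lipschitz R (fun a => - V' a) (fun a => - V'' a)); first exact: ltW.
by move=> a; apply: cvgN; exact: cV''.
Qed.

Lemma energy_confines a p : p ^+ 2 / 2 + V a = E -> `|a| < M.
Proof.
move=> energy; rewrite ltNge; apply/negP => /well.
by rewrite -energy gtrDr ltNge divr_ge0// sqr_ge0.
Qed.

Lemma ode_sol_frozen x p : ode_sol (fun a => - V' a) x p ->
  p 0 ^+ 2 / 2 + V (x 0) = E -> ode_sol frozen_force x p.
Proof.
move=> sol energy0 t; have [dx dp] := sol t; split=> //.
rewrite frozen_force_id// ltW// (@energy_confines _ (p t))//.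
by rewrite (ode_sol_energy dV sol t 0).
Qed.

(* Energy conservation for the frozen potential keeps the orbit from reaching
   +-M, where the frozen potential still equals V. *)
Lemma ode_sol_thaw x p : ode_sol frozen_force x p ->
  p 0 ^+ 2 / 2 + V (x 0) = E -> ode_sol (fun a => - V' a) x p.
Proof.
move=> sol energy0; have x0M := energy_confines energy0.
have [L lipF] := frozen_force_lipschitz; have cF := lipschitz_continuous lipF.
have [U [U0 dU]] := continuous_has_antiderivative (- V 0) cF.
have UE a : `|a| <= M -> U a = - V a.
  have dUV (b : R) : is_derive b 1 (fun b => U b + V b) (frozen_force b + V' b).
    exact: is_deriveD.
  move=> aM; apply/eqP; rewrite -subr_eq0 opprK -(addNr (V 0)) -U0; apply/eqP.
  have dUV0 b : `|b| <= `|a| -> frozen_force b + V' b = 0.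
    by move=> ba; rewrite frozen_force_id ?addNr// (le_trans ba).
  have [a_ge0|a_lt0] := leP 0 a.
    apply/esym/(is_derive_eq0_eq dUV) => // b /andP[b_gt0 ba].
    by rewrite dUV0// !ger0_norm// ltW.
  apply: (is_derive_eq0_eq dUV) (ltW a_lt0) => b /andP[ab b_lt0].
  by rewrite dUV0// !ltr0_norm// lerN2 ltW.
have energy t : p t ^+ 2 / 2 - U (x t) = E.
  by rewrite (ode_sol_energy_primitive dU sol t 0) UE ?opprK// ltW.
suff xM t : `|x t| < M.
  by move=> t; have [dx dp] := sol t; split; rewrite // -frozen_force_id// ltW.
rewrite ltNge; apply/negP => Mxt; have [cx _] := ode_sol_continuous sol.
have cnx : continuous (fun s => `|x s|).
  by move=> s; apply: continuous_comp; [exact: cx|exact: norm_continuous].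
have [|s _ xsM] := @continuous_ivt R _ 0 t M cnx; first by rewrite Mxt ltW.
have := energy s; rewrite UE ?xsM// opprK => /energy_confines.
by rewrite xsM ltxx.
Qed.

Lemma confined_ode_sol_exists x0 p0 : p0 ^+ 2 / 2 + V x0 = E ->
  exists x p, [/\ ode_sol (fun a => - V' a) x p, x 0 = x0 & p 0 = p0].
Proof.
move=> energy0; have [L lipF] := frozen_force_lipschitz.
have [x [p [sol x0E p0E]]] := ode_sol_exists x0 p0 lipF.
by exists x, p; split=> //; apply: ode_sol_thaw; rewrite // x0E p0E.
Qed.

End PotentialWell.

Section Lambda.
Variable R : realType.
Variables (d m1 m2 h g : R).
Hypotheses (d_gt0 : 0 < d) (m1_gt0 : 0 < m1) (m2_gt0 : 0 < m2) (h_lt0 : h < 0).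
Implicit Types (t l p : R).

Definition Vlam l : R := Hlam d m1 m2 h l 0.

Definition lam_force l : R := - dHlam d m1 m2 h l.

Let a := d * (m1 + m2).
Let b := - (h * d ^+ 2).

Let a_gt0 : 0 < a. Proof. by rewrite mulr_gt0// addr_gt0. Qed.
Let b_gt0 : 0 < b. Proof. by rewrite oppr_gt0 nmulr_rlt0// exprn_gt0. Qed.

Lemma HlamE l p : Hlam d m1 m2 h l p = p ^+ 2 / 2 + Vlam l.
Proof. by rewrite /Vlam /Hlam expr0n/= mul0r; ring. Qed.

Lemma VlamE l : Vlam l = b * coshR l ^+ 2 - a * coshR l.
Proof. by rewrite /Vlam /Hlam /a /b expr0n/=; ring. Qed.

Lemma is_derive_Vlam l : is_derive l 1 Vlam (dHlam d m1 m2 h l).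
Proof.
have dcosh := is_derive_coshR l.
by apply: is_derive_eq; rewrite /dHlam /GRing.scale/=; ring.
Qed.

Lemma is_derive_dHlam l : is_derive l 1 (dHlam d m1 m2 h)
  (2 * b * (coshR l ^+ 2 + sinhR l ^+ 2) - a * coshR l).
Proof.
have dcosh := is_derive_coshR l; have dsinh := is_derive_sinhR l.
by apply: is_derive_eq; rewrite /a /b /GRing.scale/=; ring.
Qed.

Lemma dHlamN l : dHlam d m1 m2 h (- l) = - dHlam d m1 m2 h l.
Proof. by rewrite /dHlam coshRN sinhRN; ring. Qed.

Lemma continuous_d2Hlam :
  continuous (fun l => 2 * b * (coshR l ^+ 2 + sinhR l ^+ 2) - a * coshR l).
Proof.
pose third l := 8 * b * coshR l * sinhR l - a * sinhR l.
apply: (@is_derive_continuous R _ third) => l.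
have dcosh := is_derive_coshR l; have dsinh := is_derive_sinhR l.
by apply: is_derive_eq; rewrite /third /GRing.scale/=; ring.
Qed.

Lemma Vlam_coercive : exists2 M : R, 0 < M & forall l, M <= `|l| -> - g < Vlam l.
Proof.
pose C := (a + `|g|) / b + 1.
have C_gt0 : 0 < C by rewrite ltr_wpDl// divr_ge0 ?(ltW b_gt0)// addr_ge0// ltW.
exists (2 * C) => [|l lC]; first by rewrite mulr_gt0.
have coshC : C <= coshR l by have := coshR_ge_affine l; lra.
have bcosh : a + `|g| + b <= b * coshR l.
  by have := ler_wpM2l (ltW b_gt0) coshC; rewrite /C mulrDr mulr1 mulrC divfK ?gt_eqF.
apply: (@le_lt_trans _ _ `|g|); first by rewrite -normrN ler_norm.
have -> : Vlam l = coshR l * (b * coshR l - a) by rewrite VlamE; ring.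
apply: (@lt_le_trans _ _ (b * coshR l - a)); first by have := b_gt0; lra.
rewrite ler_peMl ?coshR_ge1// subr_ge0 (le_trans _ bcosh)//.
by rewrite -addrA lerDl addr_ge0// ltW.
Qed.

Lemma lam_energy (l pl : R -> R) t (s : R) : lam_sol d m1 m2 h l pl ->
  Hlam d m1 m2 h (l t) (pl t) = Hlam d m1 m2 h (l s) (pl s).
Proof. by move=> sol; rewrite !HlamE; exact: (ode_sol_energy is_derive_Vlam sol). Qed.

Lemma lam_sol_exists l0 p0 : Hlam d m1 m2 h l0 p0 = - g ->
  exists l pl : R -> R, [/\ lam_sol d m1 m2 h l pl, l 0 = l0 & pl 0 = p0].
Proof.
rewrite HlamE => lev; have [M M_gt0 well] := Vlam_coercive.
exact: (confined_ode_sol_exists is_derive_Vlam is_derive_dHlam continuous_d2Hlam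
  M_gt0 well lev).
Qed.

Lemma lam_sol_lipschitz_force (l pl : R -> R) :
  lam_sol d m1 m2 h l pl -> Hlam d m1 m2 h (l 0) (pl 0) = - g ->
  exists (F : R -> R) L, [/\ L.-lipschitz F, forall x, F (- x) = - F x & ode_sol F l pl].
Proof.
move=> sol; rewrite HlamE => lev; have [M M_gt0 well] := Vlam_coercive.
have [L lipF] := frozen_force_lipschitz is_derive_dHlam continuous_d2Hlam M_gt0.
exists (frozen_force (dHlam d m1 m2 h) M), L; split=> //.
  exact/frozen_forceN/dHlamN.
exact: (ode_sol_frozen is_derive_Vlam well sol lev).
Qed.

Hypothesis reg : regular_lam d m1 m2 h (- g).
Variables (l pl : R -> R) (T : R).
Hypotheses (sol : lam_sol d m1 m2 h l pl) (lev : Hlam d m1 m2 h (l 0) (pl 0) = - g).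
Hypotheses (leastT : least_period (returns l pl) T) (saddle : Vlam 0 <= - g).

Let lev_at t : Hlam d m1 m2 h (l t) (pl t) = - g.
Proof. by rewrite (lam_energy t 0 sol). Qed.

(* Otherwise cosh l takes at its extrema two values c1 < c2 greater than 1 with
   b c^2 - a c = -g, against the strict convexity of b c^2 - a c on [1, c2]. *)
Lemma lam_reaches_zero : exists t, l t = 0.
Proof.
apply: contrapT => no_zero; have [T_gt0 [retT _]] := leastT.
have l_neq0 t : setT t -> l t != 0 by move=> _; apply/eqP => lt0; apply: no_zero; exists t.
have noneq t : lam_force (l t) != 0 \/ pl t != 0.
  by rewrite /lam_force oppr_eq0; exact: reg (lev_at t).
have [tm [tM [pm pM l_lt]]] :=
  nonequilibrium_turning_points (F := lam_force) sol T_gt0 retT noneq.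
have [t1 [t2 [pt1 pt2 /andP[l1_gt0 l12]]]] :
    exists t1 t2, [/\ pl t1 = 0, pl t2 = 0 & 0 < `|l t1| < `|l t2|].
  have [cl _] := ode_sol_continuous (F := lam_force) sol.
  have itvT : is_interval [set: R] by [].
  have [l_gt0|l_lt0] := continuous_neq0_sign cl itvT l_neq0.
    by exists tm, tM; rewrite !gtr0_norm ?l_gt0.
  by exists tM, tm; rewrite !ltr0_norm ?l_lt0// oppr_gt0 ltrN2 l_lt0.
have turning t : pl t = 0 -> b * coshR (l t) ^+ 2 - a * coshR (l t) = - g.
  by move=> pt; rewrite -VlamE -[RHS](lev_at t) HlamE pt expr0n/= mul0r add0r.
have := saddle; rewrite VlamE coshR0 => saddle1.
have cosh12 : 1 < coshR (l t1) < coshR (l t2).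
  by rewrite -coshR0 !ltr_coshR_norm// normr0.
have := quadratic_lt_between b_gt0 cosh12 saddle1 (c := - g).
by rewrite !turning// lexx ltxx => /(_ isT).
Qed.

Lemma lam_zero_times : exists u0, forall t, l t = 0 <-> progression u0 (T / 2) t.
Proof.
have [u0 lu0] := lam_reaches_zero; exists u0 => t.
have [F [L [lipF oddF solF]]] := lam_sol_lipschitz_force sol lev.
rewrite -lu0; apply: (center_passages lipF solF _ leastT).
  by move=> x; rewrite lu0 addr0 sub0r oddF.
by have [] := reg (lev_at u0); rewrite // lu0 /dHlam sinhR0 !mulr0 subr0 eqxx.
Qed.

End Lambda.

(** * The motion in nu *)

Section Angles.
Variable R : realType.
Implicit Types (x y c s : R) (i j k : int).

Lemma sin_add_int2pi x k : sin (x + k%:~R * (2 * pi)) = sin x.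
Proof.
apply/(@shift_invariant_intmul R (fun y => sin y = sin x)) => // y.
by rewrite mulr_natl sinD2pi.
Qed.

Lemma cos_add_int2pi x k : cos (x + k%:~R * (2 * pi)) = cos x.
Proof.
apply/(@shift_invariant_intmul R (fun y => cos y = cos x)) => // y.
by rewrite mulr_natl cosD2pi.
Qed.

Lemma sinNpihalf : sin (- (pi / 2)) = -1 :> R.
Proof. by rewrite sinN sin_pihalf. Qed.

Lemma cosNpihalf : cos (- (pi / 2)) = 0 :> R.
Proof. by rewrite cosN cos_pihalf. Qed.

Lemma int_even_or_odd j : exists i, j = 2 * i \/ j = 2 * i + 1.
Proof. by exists (j %/ 2)%Z; lia. Qed.

Lemma cos_eq0P x : cos x = 0 <-> progression (- (pi / 2)) pi x.
Proof.
have inv y : cos (y + pi) = 0 <-> cos y = 0.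
  by rewrite cosDpi; split=> [/eqP|->]; [rewrite oppr_eq0 => /eqP|rewrite oppr0].
split=> [cosx|[j ->]]; last by apply/(shift_invariant_intmul inv); exact: cosNpihalf.
have [j [y [xE /andP[y_ge y_lt]]]] := exists_intmul_translate x (- (pi / 2)) (pi_gt0 R).
exists j; rewrite xE; congr (_ + _); apply/eqP; rewrite eq_le y_ge andbT leNgt.
apply/negP => y_gt; have cosy : cos y = 0 by apply/(shift_invariant_intmul inv j); rewrite -xE.
have : 0 < cos y by apply: cos_gt0_pihalf; rewrite y_gt/=; lra.
by rewrite cosy ltxx.
Qed.

Lemma sin_progression j :
  sin (- (pi / 2) + j%:~R * pi) = if (2 %| j)%Z then -1 else 1 :> R.
Proof.
have [i [->|->]] := int_even_or_odd j.
  have -> : (2 %| 2 * i)%Z by rewrite dvdz_mulr.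
  have -> : (2 * i)%:~R * pi = i%:~R * (2 * pi) :> R by rewrite intrM; ring.
  by rewrite sin_add_int2pi sinNpihalf.
have -> : (2 %| 2 * i + 1)%Z = false by apply/negbTE; lia.
have -> : - (pi / 2) + (2 * i + 1)%:~R * pi = pi / 2 + i%:~R * (2 * pi) :> R.
  by rewrite intrD intrM; field.
by rewrite sin_add_int2pi sin_pihalf.
Qed.

Lemma sin_of_cos_eq0 x : cos x = 0 -> sin x = 1 \/ sin x = -1.
Proof. by move=> /cos_eq0P[j ->]; rewrite sin_progression; case: ifP; [right|left]. Qed.

Lemma eqmod2pi_sinP x c : cos c = 0 -> eqmod2pi x c <-> sin x = sin c.
Proof.
move=> cosc; split=> [[k ->]|sinx]; first exact: sin_add_int2pi.
have cosx : cos x = 0.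
  by apply: sin1cos0; rewrite sinx; case: (sin_of_cos_eq0 cosc) => ->; rewrite ?normrN normr1.
move: cosx cosc sinx => /cos_eq0P[j ->] /cos_eq0P[k ->]; rewrite !sin_progression => same_sin.
have same_parity : (2 %| j)%Z = (2 %| k)%Z.
  by move: same_sin; case: (2 %| j)%Z; case: (2 %| k)%Z => //; lra.
have [i jE] : exists i, j = k + i * 2 by exists ((j - k) %/ 2)%Z; lia.
by exists i; rewrite jE intrD intrM; ring.
Qed.

Lemma sin_reflect c x : cos c = 0 -> sin (c + c - x) = sin x.
Proof.
move=> cosc; rewrite sinB sinD cosD cosc !mulr0 !mul0r addr0 sub0r mul0r sub0r mulNr opprK.
by have := cos2Dsin2 c; rewrite cosc expr0n/= add0r expr2 => ->; rewrite mul1r.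
Qed.

Lemma cos_reflect c x : cos c = 0 -> cos (c + c - x) = - cos x.
Proof.
move=> cosc; rewrite cosB sinD cosD cosc !mulr0 !mul0r addr0 sub0r mul0r addr0 mulNr.
by have := cos2Dsin2 c; rewrite cosc expr0n/= add0r expr2 => ->; rewrite mul1r.
Qed.

Lemma sin_onto_between_cos_zeros x y s : cos x = 0 -> cos y = 0 -> x < y ->
  -1 <= s <= 1 -> exists2 z, x <= z <= y & sin z = s.
Proof.
move=> cosx cosy xy /andP[s_ge s_le]; have pi_gt0 := pi_gt0 R.
have gap : x + pi <= y.
  move: (cosx) cosy xy => /cos_eq0P[j ->] /cos_eq0P[k ->].
  rewrite ltrD2l ltr_pM2r// ltr_int -addrA lerD2l => jk.
  have : (j + 1)%:~R * pi <= k%:~R * pi :> R by rewrite ler_pM2r// ler_int; lia.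
  by rewrite intrD mulrDl mul1r.
have [u [w [ux wx suw]]] : exists u w, [/\ x <= Num.min u w, Num.max u w <= x + pi &
    sin u <= s <= sin w].
  have sinDx : sin (x + pi) = - sin x by rewrite sinDpi.
  have [sinx|sinx] := sin_of_cos_eq0 cosx; [exists (x + pi), x|exists x, (x + pi)];
    rewrite le_min ge_max sinDx sinx lexx lerDl ltW//; split=> //; lra.
have [z /andP[uz zw] sinz] := continuous_ivt (@continuous_sin R) suw.
by exists z; rewrite ?(le_trans ux)//= (le_trans zw)// (le_trans wx).
Qed.

Definition axis_symbol x (a : nat) : Prop :=
  (a = 1%N /\ sin x = -1) \/ (a = 2%N /\ sin x = 1).

Definition axis_crossings (v : R -> R) (sep : int -> nat) t0 al : Prop :=
  (forall t, cos (v t) = 0 <-> progression t0 al t) /\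
  forall i, axis_symbol (v (t0 + i%:~R * al)) (sep i).

Lemma axis_crossings_reflect (v : R -> R) sep t0 al c : cos c = 0 ->
  axis_crossings (fun t => c + c - v t) sep t0 al -> axis_crossings v sep t0 al.
Proof.
move=> cosc [zeros symbols]; split=> [t|i]; last first.
  by have := symbols i; rewrite /axis_symbol sin_reflect.
by rewrite -zeros cos_reflect//; split=> [->|/eqP]; rewrite ?oppr0// oppr_eq0 => /eqP.
Qed.

Definition returns_mod2pi (v pv : R -> R) T : Prop :=
  forall t, eqmod2pi (v (t + T)) (v t) /\ pv (t + T) = pv t.

Lemma returns_mod2pi_translate (v pv : R -> R) k T :
  returns_mod2pi (fun t => v t + k%:~R * (2 * pi)) pv T <-> returns_mod2pi v pv T.
Proof.
by split=> ret t; have [[j vt] pt] := ret t; split=> //; exists j; lra.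
Qed.

Lemma returns_mod2pi_reflect (v pv : R -> R) c T :
  returns_mod2pi (fun t => c + c - v t) (fun t => - pv t) T <-> returns_mod2pi v pv T.
Proof.
split=> ret t; have [[j vt] pt] := ret t; last first.
  by split; [exists (- j); rewrite mulrNz; lra | rewrite pt].
by split; [exists (- j); rewrite mulrNz; lra | exact: oppr_inj].
Qed.

End Angles.

Section Nu.
Variable R : realType.
Variables (d m1 m2 h g : R).
Implicit Types (t s x y c T : R) (v pv w pw : R -> R) (k : int).

Definition Vnu x : R := Hnu d m1 m2 h x 0.

Definition nu_force x : R := - dHnu d m1 m2 h x.

Let e := d * (m1 - m2).
Let b := - (h * d ^+ 2).

Lemma HnuE x (p : R) : Hnu d m1 m2 h x p = p ^+ 2 / 2 + Vnu x.
Proof. by rewrite /Vnu /Hnu expr0n/= mul0r; ring. Qed.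

Lemma VnuE x : Vnu x = e * sin x - b * sin x ^+ 2.
Proof. by rewrite /Vnu /Hnu /e /b expr0n/=; ring. Qed.

Lemma dHnuE x : dHnu d m1 m2 h x = (e - 2 * b * sin x) * cos x.
Proof. by rewrite /dHnu /e /b; ring. Qed.

Lemma Vnu_add_int2pi x k : Vnu (x + k%:~R * (2 * pi)) = Vnu x.
Proof. by rewrite !VnuE sin_add_int2pi. Qed.

Lemma is_derive_Vnu x : is_derive x 1 Vnu (dHnu d m1 m2 h x).
Proof. by apply: is_derive_eq; rewrite /dHnu /GRing.scale/=; ring. Qed.

Lemma nu_force_lipschitz : exists L, L.-lipschitz nu_force.
Proof.
exists (`|e| + 2 * `|b|).
have dnu_force x : is_derive x 1 nu_force (e * sin x + 2 * b * cos (x + x)).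
  apply: is_derive_eq; rewrite cosD /e /b /GRing.scale/=; ring.
apply: (is_derive_lipschitz dnu_force) => x; apply: le_trans (ler_normD _ _) _.
rewrite !normrM normr_nat lerD//; first by rewrite ler_piMr// sin_max.
by rewrite ler_piMr ?cos_max// mulr_ge0.
Qed.

Lemma nu_energy v pv t s : nu_sol d m1 m2 h v pv ->
  Hnu d m1 m2 h (v t) (pv t) = Hnu d m1 m2 h (v s) (pv s).
Proof. by move=> sol; rewrite !HnuE; exact: (ode_sol_energy is_derive_Vnu sol). Qed.

Lemma nu_sol_exists x0 p0 :
  exists v pv, [/\ nu_sol d m1 m2 h v pv, v 0 = x0 & pv 0 = p0].
Proof. by have [L lipF] := nu_force_lipschitz; exact: ode_sol_exists lipF. Qed.

Lemma nu_sol_unique v pv w pw t0 : nu_sol d m1 m2 h v pv -> nu_sol d m1 m2 h w pw ->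
  v t0 = w t0 -> pv t0 = pw t0 -> forall t, v t = w t /\ pv t = pw t.
Proof. by have [L lipF] := nu_force_lipschitz; exact: (ode_sol_unique lipF). Qed.

Lemma nu_sol_shift v pv s : nu_sol d m1 m2 h v pv ->
  nu_sol d m1 m2 h (fun t => v (t + s)) (fun t => pv (t + s)).
Proof. exact: (@ode_sol_shift R nu_force). Qed.

Lemma nu_sol_translate v pv k : nu_sol d m1 m2 h v pv ->
  nu_sol d m1 m2 h (fun t => v t + k%:~R * (2 * pi)) pv.
Proof.
move=> sol t; have [dv dp] := sol t; split; first by apply: is_derive_eq; rewrite addr0.
by rewrite dHnuE cos_add_int2pi sin_add_int2pi -dHnuE.
Qed.

Lemma nu_force_reflect c : cos c = 0 -> forall x, nu_force (c + c - x) = - nu_force x.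
Proof. by move=> cosc x; rewrite /nu_force !dHnuE sin_reflect// cos_reflect// mulrN. Qed.

Lemma nu_sol_reflect v pv c : cos c = 0 -> nu_sol d m1 m2 h v pv ->
  nu_sol d m1 m2 h (fun t => c + c - v t) (fun t => - pv t).
Proof. by move=> /nu_force_reflect; exact: (@ode_sol_reflect R nu_force). Qed.

Lemma nu_sol_recurrence v pv t0 T : nu_sol d m1 m2 h v pv ->
  eqmod2pi (v (t0 + T)) (v t0) -> pv (t0 + T) = pv t0 ->
  exists k, forall t, v (t + T) = v t + k%:~R * (2 * pi) /\ pv (t + T) = pv t.
Proof.
move=> sol [k vT] pT; exists k.
exact: (nu_sol_unique (t0 := t0) (nu_sol_shift T sol) (nu_sol_translate k sol)).
Qed.

Hypothesis reg : regular_nu d m1 m2 h g.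

Lemma Vnu_lt_level : (forall x, Vnu x <= g) -> forall x, Vnu x < g.
Proof.
move=> V_le x; rewrite lt_neqAle V_le andbT; apply/eqP => Vx.
have V'x : dHnu d m1 m2 h x = 0.
  by apply: (is_derive_at_max is_derive_Vnu); near=> y; rewrite Vx V_le.
by have [] := reg Vx; rewrite ?V'x eqxx.
Unshelve. all: by end_near. Qed.

Section Orbit.
Variables (v pv : R -> R) (T : R).
Hypotheses (sol : nu_sol d m1 m2 h v pv) (lev : Hnu d m1 m2 h (v 0) (pv 0) = g).
Hypothesis leastT : least_period (returns_mod2pi v pv) T.

Let T_gt0 : 0 < T := leastT.1.
Let cv : continuous v := (ode_sol_continuous (F := nu_force) sol).1.
Let pi2_gt0 : 0 < 2 * pi :> R. Proof. by rewrite mulr_gt0// pi_gt0. Qed.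

Let lev_at t : Hnu d m1 m2 h (v t) (pv t) = g.
Proof. by rewrite (nu_energy t 0 sol). Qed.

Let exists_winding_number :
  exists k, forall t, v (t + T) = v t + k%:~R * (2 * pi) /\ pv (t + T) = pv t.
Proof. by have [_ [/(_ 0)[vT pT] _]] := leastT; exact: nu_sol_recurrence vT pT. Qed.

Section Winding.
Hypothesis pv_gt0 : forall t, 0 < pv t.

Lemma winding_ltr t s : t < s -> v t < v s.
Proof. by move=> ts; apply: (is_derive_gt0_lt (fun u => (sol u).1) _ ts). Qed.

Lemma winding_speed t s : sin (v t) = sin (v s) -> pv t = pv s.
Proof.
move=> sin_ts; apply/eqP; rewrite -(@eqrXn2 _ 2) ?ltW//; apply/eqP.
by have := lev_at t; rewrite -(lev_at s) !HnuE !VnuE sin_ts; lra.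
Qed.

Lemma winding_step t : v (t + T) = v t + 2 * pi.
Proof.
have [k stepk] := exists_winding_number.
suff k1 : k = 1 by rewrite (stepk t).1 k1 mul1r.
have tT : t < t + T by rewrite ltrDl.
have k_gt0 : 0 < k.
  by have := winding_ltr tT; rewrite (stepk t).1 ltrDl pmulr_lgt0// ltr0z.
apply/eqP; rewrite eq_le (_ : 1 <= k)// andbT leNgt; apply/negP => k_gt1.
have full_turn : v t + 2 * pi < v (t + T).
  by rewrite (stepk t).1 ltrD2l -[ltLHS]mul1r ltr_pM2r// -[1]/(1%:~R) ltr_int.
have [|u] := @continuous_ivt R v t (t + T) (v t + 2 * pi) cv.
  by rewrite lerDl !ltW.
rewrite (min_idPl (ltW tT)) (max_idPr (ltW tT)) => /andP[tu uT] vu.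
have t_lt_u : t < u.
  by rewrite lt_neqAle tu andbT; apply/eqP => tuE; move: vu pi2_gt0; rewrite tuE; lra.
have u_lt : u < t + T.
  by rewrite lt_neqAle uT andbT; apply/eqP => uE; move: full_turn; rewrite -uE vu ltxx.
have [_ [_ /(_ (u - t))]] := leastT; apply; first by rewrite subr_gt0 t_lt_u ltrBlDl.
have vu2pi : v (t + (u - t)) = v t + 1%:~R * (2 * pi) by rewrite subrKC mul1r.
have [||j recj s] := @nu_sol_recurrence v pv t (u - t) sol.
- by exists 1.
- by apply: winding_speed; rewrite vu2pi sin_add_int2pi.
by have [vs ps] := recj s; split; [exists j|].
Qed.

(* Reversing time about t and reflecting v about v t preserves both the
   equation and the position and speed at t. *)
Lemma winding_half_step t : cos (v t) = 0 -> v (t + T / 2) = v t + pi.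
Proof.
move=> cosvt; have rev := ode_sol_shift (- (t + t)) (ode_sol_reverse (F := nu_force) sol).
have tE : - (t - (t + t)) = t by ring.
have [||refl _] := nu_sol_unique (t0 := t) sol (nu_sol_reflect cosvt rev) _ _ (t + T / 2).
- by rewrite tE addrK.
- by rewrite tE opprK.
move: refl; have -> : - (t + T / 2 - (t + t)) = t - T / 2 by ring.
have := winding_step (t - T / 2).
by have -> : t - T / 2 + T = t + T / 2 by [field]; lra.
Qed.

Lemma winding_half_steps t i : cos (v t) = 0 -> v (t + i%:~R * (T / 2)) = v t + i%:~R * pi.
Proof.
move=> cosvt; have [n [->|->]] := int_even_or_odd i.
  have -> : (2 * n)%:~R * (T / 2) = n%:~R * T by rewrite intrM; field.
  by rewrite (shift_additive_intmul winding_step) intrM; ring.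
have -> : t + (2 * n + 1)%:~R * (T / 2) = (t + T / 2) + n%:~R * T.
  by rewrite intrD intrM; field.
by rewrite (shift_additive_intmul winding_step) winding_half_step// intrD intrM; ring.
Qed.

Lemma winding_reaches x : exists t, sin (v t) = sin x.
Proof.
have [j [r [-> /andP[r_ge r_lt]]]] := exists_intmul_translate x (v 0) pi2_gt0.
have [|t _ <-] := @continuous_ivt R v 0 (0 + T) r cv.
  by rewrite r_ge winding_step ltW.
by exists t; rewrite sin_add_int2pi.
Qed.

Lemma winding_axis_crossings_forward : exists t0, axis_crossings v sepL t0 (T / 2).
Proof.
have [t0 sint0] := winding_reaches (- (pi / 2)); rewrite sinNpihalf in sint0.
have cost0 : cos (v t0) = 0 by apply: sin1cos0; rewrite sint0 normrN normr1.
have [k vt0] : eqmod2pi (v t0) (- (pi / 2)).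
  by apply/eqmod2pi_sinP; rewrite ?cosNpihalf// sinNpihalf.
have steps i : v (t0 + i%:~R * (T / 2)) = - (pi / 2) + (2 * k + i)%:~R * pi.
  by rewrite winding_half_steps// vt0 intrD intrM; ring.
exists t0; split=> [t|i]; last first.
  rewrite /axis_symbol steps sin_progression /sepL.
  have -> : (2 %| 2 * k + i)%Z = (2 %| i)%Z by lia.
  by case: ifP => _; [left|right].
split=> [/cos_eq0P[j vtE]|[i ->]]; last by rewrite steps; apply/cos_eq0P; exists (2 * k + i).
exists (j - 2 * k); have vt : v t = v (t0 + (j - 2 * k)%:~R * (T / 2)).
  by rewrite steps subrKC.
have [/winding_ltr|/winding_ltr|//] := ltgtP t (t0 + (j - 2 * k)%:~R * (T / 2));
  by rewrite vt ltxx.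
Qed.

End Winding.

Section Oscillation.
Variable nu0 : R.
Hypothesis barrier : g < Vnu nu0.

Lemma oscillation_avoids t s x : v t <= x <= v s -> sin x != sin nu0.
Proof.
move=> /(continuous_ivt cv)[u _ <-]; apply/eqP => sinu.
have := barrier; rewrite -(lev_at u) HnuE !VnuE sinu gtrDr.
by rewrite ltNge divr_ge0// sqr_ge0.
Qed.

Lemma oscillation_lt_full_turn t s : v s < v t + 2 * pi.
Proof.
rewrite ltNge; apply/negP => vts.
have [j [r [nuE /andP[r_ge r_lt]]]] := exists_intmul_translate nu0 (v t) pi2_gt0.
have := @oscillation_avoids t s r; rewrite nuE sin_add_int2pi eqxx r_ge/=.
by rewrite ltW ?(lt_le_trans r_lt)// => /(_ isT).
Qed.

Lemma oscillation_returns : returns v pv T.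
Proof.
have [k stepk] := exists_winding_number; suff k0 : k = 0.
  by move=> t; have := stepk t; rewrite k0 mul0r addr0.
have k_lt1 : k < 1.
  have := oscillation_lt_full_turn 0 (0 + T); rewrite (stepk 0).1 ltrD2l.
  by rewrite -[ltRHS]mul1r ltr_pM2r// -[1]/(1%:~R) ltr_int.
have k_gtN1 : -1 < k.
  have := oscillation_lt_full_turn (0 + T) 0; rewrite (stepk 0).1 -addrA ltrDl.
  by rewrite -[X in _ + X]mul1r -mulrDl pmulr_lgt0// -[1]/(1%:~R) -intrD ltr0z; lia.
lia.
Qed.

Lemma oscillation_least_period : least_period (returns v pv) T.
Proof.
apply: least_period_sub oscillation_returns leastT => T' retT' t.
by have [-> ->] := retT' t; split=> //; exists 0; rewrite mul0r addr0.
Qed.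

Hypotheses (d_gt0 : 0 < d) (h_lt0 : h < 0).

(* Otherwise sin is monotone on the range of v, so its value at the midpoint of
   the range lies strictly between its values s1, s2 at the turning points;
   there b s^2 - e s equals -g, and strict convexity puts the midpoint in the
   forbidden region. *)
Lemma oscillation_crosses_axis : exists t, cos (v t) = 0.
Proof.
apply: contrapT => no_zero.
have noneq t : nu_force (v t) != 0 \/ pv t != 0.
  by rewrite /nu_force oppr_eq0; exact: reg (lev_at t).
have [tm [tM [pm pM v_lt]]] :=
  nonequilibrium_turning_points (F := nu_force) sol T_gt0 oscillation_returns noneq.
have cos_neq0 x : v tm < x < v tM -> cos x != 0.
  move=> /andP[vx xv]; have [|t _ <-] := @continuous_ivt R v tm tM x cv; first by rewrite !ltW.
  by apply/eqP => cost; apply: no_zero; exists t.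
have mid : v tm < (v tm + v tM) / 2 < v tM by apply/andP; split; lra.
have [|t _ vt] := @continuous_ivt R v tm tM ((v tm + v tM) / 2) cv.
  by case/andP: mid => *; rewrite !ltW.
have b_gt0 : 0 < b by rewrite oppr_gt0 nmulr_rlt0// exprn_gt0.
have turning u : pv u = 0 -> b * sin (v u) ^+ 2 - e * sin (v u) = - g.
  by move=> pu; rewrite -(lev_at u) HnuE pu expr0n/= mul0r add0r VnuE opprB.
have allowed : - g <= b * sin (v t) ^+ 2 - e * sin (v t).
  rewrite -(lev_at t) HnuE VnuE; have := sqr_ge0 (pv t); lra.
suff : b * sin (v t) ^+ 2 - e * sin (v t) < - g by rewrite ltNge allowed.
rewrite vt; have [btw|btw] :=
    is_derive_neq0_between (@is_derive_sin R) (@continuous_cos R) cos_neq0 mid;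
  by apply: quadratic_lt_between btw _ _ => //; rewrite turning.
Qed.

Lemma oscillation_crossing_position t s :
  cos (v t) = 0 -> cos (v s) = 0 -> v t = v s.
Proof.
wlog vts : t s / v t < v s => [below cost coss|cost coss].
  by have [/below->|/below->|] := ltgtP (v t) (v s).
have sin_nu0 : -1 <= sin nu0 <= 1 by rewrite sin_geN1 sin_le1.
have [x xts /eqP] := sin_onto_between_cos_zeros cost coss vts sin_nu0.
by apply: contraTeq => _; exact: oscillation_avoids xts.
Qed.

Lemma oscillation_axis_crossings : exists t0 (c : nat),
  (c = 1 \/ c = 2)%N /\ axis_crossings v (fun=> c) t0 (T / 2).
Proof.
have [t0 cost0] := oscillation_crosses_axis; exists t0.
have [L lipF] := nu_force_lipschitz.
have p_neq0 : pv t0 != 0.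
  by have [] := reg (lev_at t0); rewrite // dHnuE cost0 mulr0 eqxx.
have zeros t : cos (v t) = 0 <-> progression t0 (T / 2) t.
  rewrite -(center_passages lipF sol (nu_force_reflect cost0) oscillation_least_period p_neq0).
  by split=> [cost|->]; first exact: oscillation_crossing_position.
have same_sin i : sin (v (t0 + i%:~R * (T / 2))) = sin (v t0).
  by congr sin; apply: oscillation_crossing_position => //; apply/zeros; exists i.
have [sint0|sint0] := sin_of_cos_eq0 cost0; [exists 2%N|exists 1%N];
  (split; [by [left|right]|split=> // i]); rewrite /axis_symbol same_sin; [by right|by left].
Qed.

End Oscillation.

End Orbit.

Lemma winding_axis_crossings v pv T : nu_sol d m1 m2 h v pv ->
  Hnu d m1 m2 h (v 0) (pv 0) = g -> least_period (returns_mod2pi v pv) T ->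
  (forall x, Vnu x < g) -> exists t0, axis_crossings v sepL t0 (T / 2).
Proof.
move=> sol lev leastT V_lt; have [_ cp] := ode_sol_continuous (F := nu_force) sol.
have p_neq0 t : setT t -> pv t != 0.
  move=> _; apply/eqP => pt; have := V_lt (v t).
  by rewrite -lev (nu_energy 0 t sol) pt ltxx.
have itvT : is_interval [set: R] by [].
have [p_gt0|p_lt0] := continuous_neq0_sign cp itvT p_neq0.
  by apply: (winding_axis_crossings_forward sol lev leastT) => t; exact: p_gt0.
have cosc := cos_pihalf R; pose w t := pi / 2 + pi / 2 - v t.
have levw : Hnu d m1 m2 h (w 0) (- pv 0) = g.
  by rewrite HnuE VnuE sin_reflect// sqrrN -VnuE -HnuE.
have leastw : least_period (returns_mod2pi w (fun t => - pv t)) T.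
  apply: (least_period_sub _ _ leastT) => [T' /returns_mod2pi_reflect//|].
  by apply/returns_mod2pi_reflect; exact: leastT.2.1.
have [|t0 crossings] := winding_axis_crossings_forward (nu_sol_reflect cosc sol) levw leastw.
  by move=> t; rewrite oppr_gt0 p_lt0.
by exists t0; exact: axis_crossings_reflect crossings.
Qed.

End Nu.

(** * Interleaving two progressions *)

Section Interleaving.
Variable R : realType.
Variables W y0 : R.
Implicit Types i k m : int.

Definition separator i : R := y0 + i%:~R * W.

(* Position of the i-th separator in the increasing enumeration of separators
   and integers: i separators and floor (separator i) integers precede it. *)
Definition separator_rank i : int := i + Num.floor (separator i).

Definition block k : int := Num.ceil ((k%:~R + 1 - y0) / (W + 1)) - 1.

Definition merged k : R :=
  if k == separator_rank (block k) then separator (block k) else (k - block k)%:~R.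

Definition merged_symbol (sep : int -> nat) k : nat :=
  if k == separator_rank (block k) then sep (block k) else 3%N.

Lemma separator_neq_int i m : avoids_lattice W y0 -> separator i != m%:~R.
Proof. by move=> avoids; rewrite eq_sym /separator addrC mulrC. Qed.

Lemma separatorS i : separator (i + 1) = separator i + W.
Proof. by rewrite /separator intrD; ring. Qed.

Lemma separator_rank_le i k : (separator_rank i <= k) = (separator i < (k - i + 1)%:~R).
Proof. by rewrite -floor_lt_int /separator_rank; move: (Num.floor _) => n; lia. Qed.

Hypothesis W_gt0 : 0 < W.

Lemma separator_rank_le_block i k : (separator_rank i <= k) = (i <= block k).
Proof.
rewrite /block lerBrDr lezD1 ceil_gt_int separator_rank_le ltr_pdivlMr ?addr_gt0//.
by rewrite /separator intrD intrB; apply/idP/idP; lra.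
Qed.

Lemma separator_rank_lt_succ i : separator_rank i < separator_rank (i + 1).
Proof.
have : Num.floor (separator i) <= Num.floor (separator (i + 1)).
  by apply: le_floor; rewrite separatorS lerDl ltW.
rewrite /separator_rank; lia.
Qed.

Lemma block_eq i k : separator_rank i <= k < separator_rank (i + 1) -> block k = i.
Proof. by rewrite ltNge !separator_rank_le_block; lia. Qed.

Lemma block_separator_rank i : block (separator_rank i) = i.
Proof. by apply: block_eq; rewrite lexx separator_rank_lt_succ. Qed.

Lemma merged_separator_rank i : merged (separator_rank i) = separator i.
Proof. by rewrite /merged block_separator_rank eqxx. Qed.

Lemma merged_symbol_separator_rank sep i :
  merged_symbol sep (separator_rank i) = sep i.
Proof. by rewrite /merged_symbol block_separator_rank eqxx. Qed.

Lemma merged_between i k : separator_rank i < k < separator_rank (i + 1) ->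
  merged k = (k - i)%:~R.
Proof.
move=> /andP[ik ki]; have blk : block k = i by apply: block_eq; rewrite ltW.
by rewrite /merged blk gt_eqF.
Qed.

Lemma merged_symbol_between sep i k :
  separator_rank i < k < separator_rank (i + 1) -> merged_symbol sep k = 3%N.
Proof.
move=> /andP[ik ki]; have blk : block k = i by apply: block_eq; rewrite ltW.
by rewrite /merged_symbol blk gt_eqF.
Qed.

Lemma merged_cases k : (exists i, k = separator_rank i) \/
  exists i, separator_rank i < k < separator_rank (i + 1).
Proof.
have : separator_rank (block k) <= k by rewrite separator_rank_le_block.
rewrite le_eqVlt => /predU1P[rankE|rank_lt]; [left|right]; exists (block k) => //.
by rewrite rank_lt ltNge separator_rank_le_block -ltNge ltrDl.
Qed.

Lemma merged_lt_succ k : avoids_lattice W y0 -> merged k < merged (k + 1).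
Proof.
move=> avoids; pose i := block k.
have k_ge : separator_rank i <= k by rewrite separator_rank_le_block.
have k_lt : k < separator_rank (i + 1).
  by rewrite ltNge separator_rank_le_block -ltNge ltrDl.
have sep_lt : separator i < (k - i + 1)%:~R by rewrite -separator_rank_le.
have merged_k : merged k = separator i \/ merged k = (k - i)%:~R.
  by rewrite /merged; case: ifP; [left|right].
have [k1_lt|k1_ge] := ltP (k + 1) (separator_rank (i + 1)).
  rewrite (@merged_between i (k + 1)); last by rewrite k1_lt andbT; lia.
  by case: merged_k => ->; rewrite addrAC ?ltr_int ?ltrDl.
have -> : k + 1 = separator_rank (i + 1) by lia.
rewrite merged_separator_rank; case: merged_k => ->; first by rewrite separatorS ltrDl.
rewrite lt_neqAle eq_sym separator_neq_int//= leNgt; apply/negP => sep_lt'.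
by move: k_lt; rewrite ltNge separator_rank_le (_ : k - (i + 1) + 1 = k - i) ?sep_lt'//; lia.
Qed.

Lemma merged_onto_int m : exists i k,
  separator_rank i < k < separator_rank (i + 1) /\ merged k = m%:~R.
Proof.
pose i := Num.ceil ((m%:~R - y0) / W) - 1.
have /andP[sep_lt sep_ge] : separator i < m%:~R <= separator (i + 1).
  have /andP[] := ceil_itv ((m%:~R - y0) / W).
  by rewrite ltr_pdivlMr// ler_pdivrMr// /separator /i subrK => ? ?; apply/andP; split; lra.
have rank_le : separator_rank i <= i + m - 1.
  by rewrite separator_rank_le (_ : i + m - 1 - i + 1 = m)//; lia.
have rank_gt : i + m < separator_rank (i + 1).
  by rewrite ltNge separator_rank_le (_ : i + m - (i + 1) + 1 = m) -?leNgt//; lia.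
have between : separator_rank i < i + m < separator_rank (i + 1) by lia.
by exists i, (i + m); split=> //; rewrite (merged_between between); congr _%:~R; lia.
Qed.

Lemma separator_rank_gap i :
  separator_rank (i + 1) - separator_rank i - 1 = sturm W y0 (i + 1).
Proof.
rewrite /sturm addrK -/(separator i) /separator_rank /fracR separatorS.
have /andP[sep_ge sep_lt] := floor_itv (separator i).
have /andP[W_ge W_lt] := floor_itv W; rewrite !intrD in sep_lt W_lt.
case: ltP => frac_sum.
  suff -> : Num.floor (separator i + W) = Num.floor (separator i) + Num.floor W by lia.
  by apply: floor_def; rewrite !intrD; apply/andP; split; lra.
suff -> : Num.floor (separator i + W) = Num.floor (separator i) + Num.floor W + 1 by lia.
by apply: floor_def; rewrite !intrD; apply/andP; split; lra.
Qed.

Lemma merged_symbol_block_form sep :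
  block_form (merged_symbol sep) sep (sturm W y0).
Proof.
exists separator_rank; split; first exact: separator_rank_lt_succ.
split; first exact: merged_symbol_separator_rank.
by split; [exact: merged_symbol_between|exact: separator_rank_gap].
Qed.

End Interleaving.

Section Syzygies.
Variable R : realType.
Implicit Types (l v : R -> R) (sep : int -> nat).

Lemma eqmod2pi_cosP (x : R) :
  (eqmod2pi x (pi / 2) \/ eqmod2pi x (- (pi / 2))) <-> cos x = 0.
Proof.
rewrite !eqmod2pi_sinP ?cos_pihalf ?cosNpihalf// sin_pihalf sinNpihalf.
split; last exact: sin_of_cos_eq0.
by case=> sinx; apply: sin1cos0; rewrite sinx ?normrN normr1.
Qed.

Lemma axis_symbolP (x : R) : (exists a, axis_symbol x a) <-> cos x = 0.
Proof.
split=> [[a symb]|/sin_of_cos_eq0[sinx|sinx]].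
- by apply: sin1cos0; case: symb => -[_ ->]; rewrite ?normrN normr1.
- by exists 2%N; right.
- by exists 1%N; left.
Qed.

Lemma noncollisionP l v : noncollision l v <-> forall t, ~ (l t = 0 /\ cos (v t) = 0).
Proof. by split=> nc t; have := nc t; rewrite eqmod2pi_cosP. Qed.

Lemma syzP l v t a : syz l v t a <->
  (a = 3%N /\ l t = 0 /\ cos (v t) <> 0) \/ (axis_symbol (v t) a /\ l t != 0).
Proof.
have outside : (~ eqmod2pi (v t) (pi / 2) /\ ~ eqmod2pi (v t) (- (pi / 2))) <-> cos (v t) <> 0.
  by rewrite -eqmod2pi_cosP not_orP.
rewrite /syz outside !eqmod2pi_sinP ?cos_pihalf ?cosNpihalf// sin_pihalf sinNpihalf.
rewrite /axis_symbol; tauto.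
Qed.

Lemma axis_crossings_syzygies l v sep t0 al : 0 < al -> (forall t, l t != 0) ->
  axis_crossings v sep t0 al -> syzygy_seq l v sep.
Proof.
move=> al_gt0 l_neq0 [zeros symbols]; exists (fun k => t0 + k%:~R * al).
have syz_at k : syz l v (t0 + k%:~R * al) (sep k) by apply/syzP; right.
split=> [k|]; first by rewrite ltrD2l ltr_pM2r// ltr_int ltrDl.
split=> // t; split=> [[a /syzP[[_ [/eqP]]|[symb _]]]|[k <-]]; last by exists (sep k).
  by rewrite (negbTE (l_neq0 t)).
have [|k ->] := (zeros t).1; last by exists k.
by apply/axis_symbolP; exists a.
Qed.

Variables (l v : R -> R) (sep : int -> nat) (W y0 u0 be : R).
Hypotheses (W_gt0 : 0 < W) (be_gt0 : 0 < be).
Hypothesis zeros : forall t, l t = 0 <-> progression u0 be t.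
Hypothesis crossings : axis_crossings v sep (u0 + y0 * be) (W * be).

Let crossing_timeE i : u0 + y0 * be + i%:~R * (W * be) = u0 + separator W y0 i * be.
Proof. by rewrite /separator; ring. Qed.

Lemma noncollision_avoids_latticeP : noncollision l v <-> avoids_lattice W y0.
Proof.
rewrite noncollisionP; split=> [nc i m|avoids t [/zeros[m ->] /crossings.1[i]]].
  apply/eqP => mE; apply: (nc (u0 + m%:~R * be)); split; first by apply/zeros; exists m.
  by apply/crossings.1; exists i; rewrite mE; ring.
rewrite crossing_timeE => /addrI/(mulIf (lt0r_neq0 be_gt0))/esym/eqP.
by rewrite (negbTE (separator_neq_int i m avoids)).
Qed.

Lemma interleaved_syzygies : avoids_lattice W y0 ->
  exists s, syzygy_seq l v s /\ block_form s sep (sturm W y0).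
Proof.
move=> avoids; have /noncollisionP nc := noncollision_avoids_latticeP.2 avoids.
exists (merged_symbol W y0 sep); split; last exact: merged_symbol_block_form.
pose time k := u0 + merged W y0 k * be; exists time.
have time_rank i : time (separator_rank W y0 i) = u0 + y0 * be + i%:~R * (W * be).
  by rewrite /time merged_separator_rank// crossing_timeE.
have syz_at k : syz l v (time k) (merged_symbol W y0 sep k).
  apply/syzP; have [[i ->]|[i ik]] := merged_cases y0 W_gt0 k; [right|left].
    rewrite time_rank merged_symbol_separator_rank//; split; first exact: crossings.2.
    apply/eqP => li; apply: (nc (time (separator_rank W y0 i))); rewrite time_rank.
    by split=> //; apply/crossings.1; exists i.
  have lk : l (time k) = 0 by apply/zeros; exists (k - i); rewrite /time (merged_between _ ik).
  by rewrite (merged_symbol_between _ _ ik)//; split=> //; split=> // cosk; exact: (nc (time k)).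
split=> [k|]; first by rewrite /time ltrD2l ltr_pM2r// merged_lt_succ.
split=> // t; split=> [[a /syzP[[_ [/zeros[m ->] _]]|[symb _]]]|[k <-]].
- by have [i [k [_ <-]]] := merged_onto_int y0 W_gt0 m; exists k.
- have [|i ->] := (crossings.1 t).1; first by apply/axis_symbolP; exists a.
  by exists (separator_rank W y0 i); rewrite time_rank.
- by exists (merged_symbol W y0 sep k).
Qed.

End Syzygies.

(** * Syzygy sequences on a regular torus *)

Lemma path_in_connected_component (R : realType) (T : topologicalType) (A : set T)
    (z : T) (f : R -> T) (s t : R) : continuous f -> (forall u, A (f u)) ->
  connected_component A z (f s) -> connected_component A z (f t).
Proof.
move=> cf Af zs; apply: (connected_component_trans zs).
have connR : connected [set: R] by apply/connected_intervalP => ? ? _ _ ? _.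
apply: (connected_component_max (B := range f)); [by exists s | | | by exists t].
  by move=> _ [u _ <-].
exact: connected_continuous_connected connR (continuous_subspaceT cf).
Qed.

Lemma continuous_pair (R : realType) (f g : R -> R) :
  continuous f -> continuous g -> continuous (fun t => (f t, g t)).
Proof. by move=> cf cg t; exact: (cvg_pair (cf t) (cg t)). Qed.

Section Winding.
Variable R : realType.
Variables (d m1 m2 h g : R) (zn : R * R).
Hypotheses (reg : regular_nu d m1 m2 h g) (levn : lev_nu d m1 m2 h g zn).

Let K := connected_component (lev_nu d m1 m2 h g) zn.

Lemma winds_Vnu_lt : winds K -> forall x, Vnu d m1 m2 h x < g.
Proof.
move=> [x0 [p0 [Kx0 Kx0_turn]]]; apply: (Vnu_lt_level reg) => x.
have pi2_gt0 : 0 < 2 * pi :> R by rewrite mulr_gt0// pi_gt0.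
have /connected_intervalP proj_itv : connected (fst @` K).
  apply: connected_continuous_connected; first exact: component_connected.
  by apply: continuous_subspaceT => z; exact: cvg_fst.
have [j [r [-> /andP[r_ge r_lt]]]] := exists_intmul_translate x x0 pi2_gt0.
have [[y p] Kyp /= <-] : (fst @` K) r.
  apply: (proj_itv x0 (x0 + 2 * pi)); last by rewrite r_ge ltW.
    by exists (x0, p0).
  by exists (x0 + 2 * pi, p0).
have : Hnu d m1 m2 h y p = g := connected_component_sub Kyp.
by rewrite Vnu_add_int2pi HnuE => <-; rewrite lerDr divr_ge0// sqr_ge0.
Qed.

Lemma Vnu_lt_winds : (forall x, Vnu d m1 m2 h x < g) -> winds K.
Proof.
move=> V_lt; have lev0 : Hnu d m1 m2 h zn.1 zn.2 = g := levn.
pose q x : R := Num.sg zn.2 * Num.sqrt (2 * (g - Vnu d m1 m2 h x)).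
have kinetic_gt0 x : 0 < 2 * (g - Vnu d m1 m2 h x) by rewrite mulr_gt0// subr_gt0.
have p_neq0 : zn.2 != 0.
  by apply/eqP => p0; have := V_lt zn.1; rewrite -lev0 p0 ltxx.
have q_level x : lev_nu d m1 m2 h g (x, q x).
  rewrite /lev_nu/= HnuE /q exprMn sqr_sg p_neq0 mul1r sqr_sqrtr ?ltW//.
  by rewrite mulrC mulKf ?pnatr_eq0// subrK.
have q_zn : q zn.1 = zn.2.
  rewrite /q -lev0 HnuE addrK [2 * _]mulrC divfK ?pnatr_eq0//.
  by rewrite sqrtr_sqr -numEsg.
have cq : continuous q.
  have cV : continuous (Vnu d m1 m2 h) := is_derive_continuous (is_derive_Vnu d m1 m2 h).
  move=> x; apply: cvgM; first exact: cvg_cst.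
  apply: (@continuous_comp _ _ _ (fun x => 2 * (g - Vnu d m1 m2 h x)) Num.sqrt);
    last exact: sqrt_continuous.
  by apply: cvgM; [exact: cvg_cst | apply: cvgB; [exact: cvg_cst | exact: cV]].
have K_graph x : K (x, q x).
  apply: (path_in_connected_component (s := zn.1) (f := fun x => (x, q x))) q_level _.
    by apply: continuous_pair => // y; exact: cvg_id.
  by rewrite q_zn -surjective_pairing; exact: connected_component_refl.
exists zn.1, (q zn.1); split; first exact: K_graph.
have -> : q zn.1 = q (zn.1 + 2 * pi).
  by rewrite /q -[2 * pi]mul1r -(Vnu_add_int2pi _ _ _ _ zn.1 1).
exact: K_graph.
Qed.

Lemma not_winds_barrier : ~ winds K -> exists x, g < Vnu d m1 m2 h x.
Proof.
move=> not_winds; apply: contrapT => no_barrier; apply/not_winds/Vnu_lt_winds.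
by apply: (Vnu_lt_level reg) => x; rewrite leNgt; apply/negP => ?; apply: no_barrier; exists x.
Qed.

End Winding.

Section Torus.
Variable R : realType.
Variables (d m1 m2 h g : R) (zl zn : R * R) (Tl Tn : R).
Hypotheses (d_gt0 : 0 < d) (m1_gt0 : 0 < m1) (m2_gt0 : 0 < m2) (h_lt0 : h < 0).
Hypotheses (regl : regular_lam d m1 m2 h (- g)) (regn : regular_nu d m1 m2 h g).
Hypotheses (levl : lev_lam d m1 m2 h (- g) zl) (levn : lev_nu d m1 m2 h g zn).

Let Cl := connected_component (lev_lam d m1 m2 h (- g)) zl.
Let K := connected_component (lev_nu d m1 m2 h g) zn.
Let W := Tn / Tl.

Hypotheses (perl : lam_period d m1 m2 h Cl Tl) (pern : nu_period d m1 m2 h K Tn).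

Lemma meets_lam0_saddle : meets_lam0 Cl -> Vlam d m1 m2 h 0 <= - g.
Proof.
move=> [p /connected_component_sub]; rewrite /lev_lam /= HlamE => <-.
by rewrite lerDr divr_ge0// sqr_ge0.
Qed.

(* With Q c = b c^2 - a c, a = d (m1 + m2), the barrier at nu gives
   Q |sin nu| < -g because |m1 - m2| < m1 + m2, and C_lambda provides c >= 1 with
   Q c <= -g; convexity then gives Q 1 <= -g. *)
Lemma not_winds_saddle : ~ winds K -> Vlam d m1 m2 h 0 <= - g.
Proof.
move=> not_winds; have [x] := not_winds_barrier regn levn not_winds.
have : Hlam d m1 m2 h zl.1 zl.2 = - g := levl.
rewrite HlamE !VlamE coshR0 VnuE.
set a := d * (m1 + m2); set b := - (h * d ^+ 2) => lev barrier.
have b_gt0 : 0 < b by rewrite oppr_gt0 nmulr_rlt0// exprn_gt0.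
have right_le : b * coshR zl.1 ^+ 2 - a * coshR zl.1 <= - g.
  by rewrite -lev lerDr divr_ge0// sqr_ge0.
have left_lt : b * `|sin x| ^+ 2 - a * `|sin x| < - g.
  rewrite real_normK ?num_real// ltrNr opprB (lt_le_trans barrier)// lerB//.
  rewrite (le_trans (ler_norm _))// normrM ler_wpM2r// /a normrM gtr0_norm// ler_pM2l//.
  by rewrite (le_trans (ler_normB _ _))// !gtr0_norm.
have [->|cosh_neq1] := eqVneq 1 (coshR zl.1); first by [].
have [sin_eq1|sin_neq1] := eqVneq `|sin x| 1; first by rewrite -sin_eq1 ltW.
apply/ltW/(quadratic_lt_between b_gt0 _ (ltW left_lt) right_le).
by rewrite !lt_neqAle sin_neq1 cosh_neq1 coshR_ge1 sin_max.
Qed.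

Lemma torus_orbit_exists : exists l pl v pv,
  reg_orbit d m1 m2 h l pl v pv /\ on_torus Cl K l pl v pv.
Proof.
have [l [pl [soll l0 pl0]]] := lam_sol_exists d_gt0 m1_gt0 m2_gt0 h_lt0 levl.
have [v [pv [soln v0 pv0]]] := nu_sol_exists d m1 m2 h zn.1 zn.2.
exists l, pl, v, pv; split; first by split.
split; first by rewrite l0 pl0 -surjective_pairing; exact: connected_component_refl.
by exists 0; rewrite mul0r addr0 v0 pv0 -surjective_pairing; exact: connected_component_refl.
Qed.

Definition half_period_events (sep : int -> nat) (l v : R -> R) : Prop :=
  exists u0 t0, (forall t, l t = 0 <-> progression u0 (Tl / 2) t) /\
    axis_crossings v sep t0 (Tn / 2).

Section Orbit.
Variables l pl v pv : R -> R.
Hypotheses (orbit : reg_orbit d m1 m2 h l pl v pv) (on : on_torus Cl K l pl v pv).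

Lemma orbit_lam_in_component t : Cl (l t, pl t).
Proof.
have [soll _] := orbit; have [Cl0 _] := on.
have [cl cp] := ode_sol_continuous (F := lam_force d m1 m2 h) soll.
apply: (path_in_connected_component (s := 0) (f := fun t => (l t, pl t))) Cl0.
  exact: continuous_pair.
by move=> s; rewrite /lev_lam/= (lam_energy s 0 soll); exact: connected_component_sub on.1.
Qed.

Lemma orbit_lam_least_period : least_period (returns l pl) Tl.
Proof. exact: perl orbit.1 on.1. Qed.

Lemma orbit_nu_level : Hnu d m1 m2 h (v 0) (pv 0) = g.
Proof.
have [_ [k /connected_component_sub]] := on.
by rewrite /lev_nu/= HnuE Vnu_add_int2pi -HnuE.
Qed.

Lemma orbit_nu_least_period : least_period (returns_mod2pi v pv) Tn.
Proof.
have [_ [k Kk]] := on; have [_ soln] := orbit.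
have leastT := pern (nu_sol_translate k soln) Kk.
apply: (least_period_sub _ _ leastT) => [T' /returns_mod2pi_translate|]; first exact.
by apply/returns_mod2pi_translate; exact: leastT.2.1.
Qed.

Lemma orbit_zero_times : Vlam d m1 m2 h 0 <= - g ->
  exists u0, forall t, l t = 0 <-> progression u0 (Tl / 2) t.
Proof.
apply: (lam_zero_times d_gt0 m1_gt0 m2_gt0 h_lt0 regl orbit.1 _ orbit_lam_least_period).
exact: connected_component_sub on.1.
Qed.

Lemma orbit_winding_crossings : winds K -> exists t0, axis_crossings v sepL t0 (Tn / 2).
Proof.
move=> /(winds_Vnu_lt regn).
exact: winding_axis_crossings orbit.2 orbit_nu_level orbit_nu_least_period.
Qed.

Lemma orbit_oscillation_crossings : ~ winds K ->
  exists t0 (c : nat), (c = 1 \/ c = 2)%N /\ axis_crossings v (fun=> c) t0 (Tn / 2).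
Proof.
move=> /(not_winds_barrier regn levn)[x barrier].
exact: (oscillation_axis_crossings regn orbit.2 orbit_nu_level orbit_nu_least_period barrier).
Qed.

Lemma orbit_events_typeL : typeL Cl K -> half_period_events sepL l v.
Proof.
move=> [/orbit_winding_crossings[t0 crossings] /meets_lam0_saddle/orbit_zero_times[u0 zeros]].
by exists u0, t0.
Qed.

Lemma orbit_events_typeS : typeS Cl K ->
  exists c : nat, (c = 1 \/ c = 2)%N /\ half_period_events (fun=> c) l v.
Proof.
move=> typS; have [t0 [c [c12 crossings]]] := orbit_oscillation_crossings typS.
have [u0 zeros] := orbit_zero_times (not_winds_saddle typS).
by exists c; split=> //; exists u0, t0.
Qed.

Let Tl_gt0 : 0 < Tl := orbit_lam_least_period.1.
Let Tn_gt0 : 0 < Tn := orbit_nu_least_period.1.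
Let W_gt0 : 0 < W. Proof. by rewrite divr_gt0. Qed.
Let half_Tl_gt0 : 0 < Tl / 2. Proof. by rewrite divr_gt0. Qed.
Let half_TnE : Tn / 2 = W * (Tl / 2). Proof. by rewrite mulrA divfK ?gt_eqF. Qed.

(* In units of Tl / 2, counted from a zero of lambda, the axis crossings occur
   at y0 + i W. *)
Lemma orbit_block_form sep : noncollision l v -> half_period_events sep l v ->
  exists s y0, avoids_lattice W y0 /\ syzygy_seq l v s /\ block_form s sep (sturm W y0).
Proof.
move=> nc [u0 [t0 [zeros]]]; pose y0 := (t0 - u0) / (Tl / 2).
have -> : t0 = u0 + y0 * (Tl / 2) by rewrite divfK ?gt_eqF// subrKC.
rewrite half_TnE => crossings.
have avoids := (noncollision_avoids_latticeP half_Tl_gt0 zeros crossings).1 nc.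
have [s [syz blocks]] := interleaved_syzygies W_gt0 half_Tl_gt0 zeros crossings avoids.
by exists s, y0.
Qed.

(* Shifting lambda in time moves the intercept to any prescribed value. *)
Lemma orbit_realize_intercept sep y0 : half_period_events sep l v -> avoids_lattice W y0 ->
  exists l pl v pv, reg_orbit d m1 m2 h l pl v pv /\ on_torus Cl K l pl v pv /\
    noncollision l v /\ exists s, syzygy_seq l v s /\ block_form s sep (sturm W y0).
Proof.
move=> [u0 [t0 [zeros crossings]]] avoids; pose s := u0 - t0 + y0 * (Tl / 2).
have zeros_s t : l (t + s) = 0 <-> progression (u0 - s) (Tl / 2) t.
  by rewrite zeros; split=> -[j tE]; exists j; lra.
have crossings_s : axis_crossings v sep (u0 - s + y0 * (Tl / 2)) (W * (Tl / 2)).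
  by rewrite -half_TnE (_ : _ + _ = t0)// /s; ring.
exists (fun t => l (t + s)), (fun t => pl (t + s)), v, pv; split; [|split; [|split]].
- split; last exact: orbit.2.
  exact: (ode_sol_shift (F := lam_force d m1 m2 h) s orbit.1).
- by split; [exact: orbit_lam_in_component | exact: on.2].
- exact: (noncollision_avoids_latticeP half_Tl_gt0 zeros_s crossings_s).2 avoids.
- exact: interleaved_syzygies W_gt0 half_Tl_gt0 zeros_s crossings_s avoids.
Qed.

Lemma orbit_typeP_syzygies : typeP Cl K -> syzygy_seq l v sepL.
Proof.
move=> [/orbit_winding_crossings[t0 crossings] no_zero].
apply: axis_crossings_syzygies crossings => [|t]; first by rewrite divr_gt0.
by apply/eqP => lt; apply: no_zero; exists (pl t); rewrite -lt; exact: orbit_lam_in_component.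
Qed.

End Orbit.
End Torus.

Theorem theorem2 (R : realType) (d m1 m2 h g : R) (zl zn : R * R) (Tl Tn : R) :
  0 < d -> 0 < m1 -> 0 < m2 -> h < 0 ->
  regular_lam d m1 m2 h (- g) -> regular_nu d m1 m2 h g ->
  lev_lam d m1 m2 h (- g) zl -> lev_nu d m1 m2 h g zn ->
  let Cl := connected_component (lev_lam d m1 m2 h (- g)) zl in
  let K := connected_component (lev_nu d m1 m2 h g) zn in
  lam_period d m1 m2 h Cl Tl -> nu_period d m1 m2 h K Tn ->
  let W := Tn / Tl in
  (* direct part *)
  (forall l pl v pv : R -> R,
     reg_orbit d m1 m2 h l pl v pv -> on_torus Cl K l pl v pv ->
     noncollision l v ->
     (typeP Cl K ->
        exists s, syzygy_seq l v s /\
          (forall k : int, s k = (if (2 %| k)%Z then 1 else 2)%N)) /\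
     (typeL Cl K ->
        exists s y0, avoids_lattice W y0 /\ syzygy_seq l v s /\
          block_form s sepL (sturm W y0)) /\
     (typeS Cl K ->
        exists s y0 (c : nat), (c = 1 \/ c = 2)%N /\ avoids_lattice W y0 /\
          syzygy_seq l v s /\ block_form s (fun _ => c) (sturm W y0))) /\
  (* converse, type L *)
  (typeL Cl K ->
     forall y0, avoids_lattice W y0 ->
     exists l pl v pv : R -> R,
       reg_orbit d m1 m2 h l pl v pv /\ on_torus Cl K l pl v pv /\
       noncollision l v /\
       exists s, syzygy_seq l v s /\ block_form s sepL (sturm W y0)) /\
  (* converse, type S *)
  (typeS Cl K ->
     exists c : nat, (c = 1 \/ c = 2)%N /\
     forall y0, avoids_lattice W y0 ->
     exists l pl v pv : R -> R,
       reg_orbit d m1 m2 h l pl v pv /\ on_torus Cl K l pl v pv /\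
       noncollision l v /\
       exists s, syzygy_seq l v s /\ block_form s (fun _ => c) (sturm W y0)).
Proof.
move=> d_gt0 m1_gt0 m2_gt0 h_lt0 regl regn levl levn Cl K perl pern W.
have [L [PL [V [PV [orbit0 on0]]]]] :=
  torus_orbit_exists d_gt0 m1_gt0 m2_gt0 h_lt0 levl levn.
have eventsL := orbit_events_typeL d_gt0 m1_gt0 m2_gt0 h_lt0 regl regn perl pern.
have eventsS := orbit_events_typeS d_gt0 m1_gt0 m2_gt0 h_lt0 regl regn levl levn perl pern.
split; [|split].
- move=> l pl v pv orbit on nc; split; [|split] => [typP|typL|typS].
  + by exists sepL; split; first exact: (orbit_typeP_syzygies regn pern orbit on typP).
  + exact: (orbit_block_form perl pern orbit on nc (eventsL _ _ _ _ orbit on typL)).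
  + have [c [c12 events]] := eventsS _ _ _ _ orbit on typS.
    have [s [y0 syz]] := orbit_block_form perl pern orbit on nc events.
    by exists s, y0, c.
- move=> typL y0.
  exact: (orbit_realize_intercept perl pern orbit0 on0 (eventsL _ _ _ _ orbit0 on0 typL)).
- move=> typS; have [c [c12 events]] := eventsS _ _ _ _ orbit0 on0 typS.
  exists c; split=> // y0.
  exact: (orbit_realize_intercept perl pern orbit0 on0 events).
Qed.
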